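(* Let $A$ be a commutative, unital (complex) Banach algebra. Suppose that the maximal ideal $M_\varphi=\ker\varphi$ is countably generated for each $\varphi\in\Gamma(A)$, where $\Gamma(A)$ is the Šilov boundary of $A$. Then $A$ is finite dimensional.
   Context: All algebras are associative and over $\mathbb{C}$. For a commutative unital Banach algebra $A$, an ideal $I$ is countably generated if there is a countable set $S\subset A$ such that $I$ is the smallest ideal of $A$ containing $S$; equivalently $I=\{\sum_{i=1}^n a_is_i : n\in\mathbb{N},\ a_i\in A,\ s_i\in S\}$ (purely algebraic generation, no closure). $\Phi_A$ denotes the character space of $A$ (non-zero multiplicative linear functionals $A\to\mathbb{C}$), a compact Hausdorff space in the relative weak-$*$ topology $\sigma(A',A)$; for $\varphi\in\Phi_A$, $M_\varphi=\ker\varphi$. For $a\in A$, $\widehat{a}\in C(\Phi_A)$ is the Gel'fand transform, $\widehat a(\varphi)=\varphi(a)$, and $\widehat A=\{\widehat a: a\in A\}$. A peak set for $\widehat A$ is a non-empty closed subset $F\subset\Phi_A$ for which there is $f\in\widehat A$ with $|f(x)|=1$ for $x\in F$ and $|f(y)|<1$ for $y\in\Phi_A\setminus F$. A subset $S\subset\Phi_A$ is a boundary if $S\cap F\neq\emptyset$ for every peak set $F$. The Šilov boundary $\Gamma(A)=\Gamma(\widehat A)$ is the intersection of all closed boundaries (it is itself a closed boundary). Equivalently, $\varphi\in\Gamma(A)$ if and only if for each open neighbourhood $U$ of $\varphi$ in $\Phi_A$ there is $f\in\widehat A$ with $\sup_{\Phi_A}|f|>\sup_{\Phi_A\setminus U}|f|$.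 *)

(* Defs.v *)
From HB Require Import structures.
From mathcomp Require Import all_boot all_order all_algebra complex.
From mathcomp Require Import all_classical all_reals all_analysis.

Set Implicit Arguments.
Unset Strict Implicit.
Unset Printing Implicit Defensive.
Set Warnings "-redundant-canonical-projection".

Import Order.TTheory GRing.Theory Num.Theory.
Import numFieldNormedType.Exports.

Local Open Scope classical_set_scope.
Local Open Scope ring_scope.

(* [numFieldNormedType.Exports] equips abstract number fields only: give the
   concrete type R[i] the same norm topology. *)
HB.instance Definition _ (R : realType) := PseudoPointedMetric.copy R[i] R[i]^o.
HB.instance Definition _ (R : realType) := NormedModule.copy R[i] R[i]^o.

(* The multiplication is a field of this mixin and the ring structure is derived
   from it below, because HB rejects a structure joining [NormedModule] and
   [GRing.ComAlgebra] (no join of normed modules and rings is declared below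
   [Num.NumDomain]).
   1 != 0 is included, as in MathComp's algebras; `|1| = 1 is not assumed. *)
HB.mixin Record NormedModule_isComBanachAlgebra (K : numFieldType) (A : Type)
    & NormedModule K A := {
  banach_one : A;
  banach_mul : A -> A -> A;
  banach_mulA : associative banach_mul;
  banach_mulC : commutative banach_mul;
  banach_mul1 : left_id banach_one banach_mul;
  banach_mulDl : left_distributive banach_mul +%R;
  banach_one_neq0 : banach_one != 0;
  banach_scaleAl : forall (k : K) (a b : A),
    k *: banach_mul a b = banach_mul (k *: a) b;
  banach_normM : forall a b : A, `|banach_mul a b| <= `|a| * `|b|
}.

#[short(type="comBanachAlgType")]
HB.structure Definition ComBanachAlgebra (K : numFieldType) :=
  {A of CompleteNormedModule K A & NormedModule_isComBanachAlgebra K A}.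

#[non_forgetful_inheritance]
HB.instance Definition _ (K : numFieldType) (A : comBanachAlgType K) :=
  GRing.Zmodule_isComNzRing.Build A (@banach_mulA K A) (@banach_mulC K A)
    (@banach_mul1 K A) (@banach_mulDl K A) (@banach_one_neq0 K A).
#[non_forgetful_inheritance]
HB.instance Definition _ (K : numFieldType) (A : comBanachAlgType K) :=
  GRing.Lmodule_isLalgebra.Build K A (@banach_scaleAl K A).
#[non_forgetful_inheritance]
HB.instance Definition _ (K : numFieldType) (A : comBanachAlgType K) :=
  GRing.Lalgebra_isComAlgebra.Build K A.

Section Ideals.
Variable A : comNzRingType.

Definition is_ideal (I : set A) : Prop :=
  [/\ I 0, forall a b, I a -> I b -> I (a + b) & forall a b, I b -> I (a * b)].

Definition countably_generated (I : set A) : Prop :=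
  exists2 S : set A, countable S & I = smallest is_ideal S.

End Ideals.

Section PeakSets.
Variables (R : realType) (X : topologicalType).
Implicit Types (E : set (X -> R[i])) (F S : set X).

Definition peak_set E F : Prop :=
  [/\ F !=set0, closed F &
    exists2 f : X -> R[i], E f &
      (forall x, F x -> `|f x| = 1) /\ (forall y, ~ F y -> `|f y| < 1)].

Definition boundary E S : Prop := forall F, peak_set E F -> S `&` F !=set0.

Definition silov_boundary E : set X :=
  \bigcap_(S in [set S | closed S /\ boundary E S]) S.

End PeakSets.

Section CharacterSpace.
Variables (R : realType) (A : comBanachAlgType R[i]).

(* The relative topology of {ptws A -> R[i]} on the characters is the relative
   weak-* topology; continuity of characters is automatic and not required. *)
Definition characters : set {ptws A -> R[i]} :=
  [set f : A -> R[i] | [/\ scalar f, {morph f : a b / a * b}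
                         & exists a, f a != 0]].

Definition gelfand (a : A) : characters -> R[i] := fun phi => set_val phi a.

Definition char_ker (phi : characters) : set A := [set a | gelfand a phi = 0].

Definition silov : set characters := silov_boundary (range gelfand).

End CharacterSpace.

Arguments characters {R} A _.
Arguments silov {R} A _.

Definition finite_dimensional (K : fieldType) (V : lmodType K) : Prop :=
  exists n : nat, inhabited (Vector.axiom n V).

(* Main.v *)
Require Import Defs.
From mathcomp Require Import all_boot all_order all_algebra complex.
From mathcomp Require Import all_classical all_reals all_analysis.
From mathcomp Require Import ring lra.

(** The idempotents e with eA finite-dimensional generate an ideal J, and it
    suffices to show 1 \in J.  Otherwise the hull H of J in the character space
    is non-empty (Gelfand-Mazur) and compact.  A minimal face of H, for faces
    obtained by repeatedly maximising some |a|, is a single point phi, and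
    cutting down by idempotents of J shows that phi lies in the Silov boundary.
    By Baire, M = ker phi is then finitely generated with norm control on the
    coefficients.  No power M^k equals M^(k+1): by Nakayama it would be
    generated by an idempotent e, whose complement 1 - e would be in J without
    vanishing at phi; the same holds modulo J because J is contained in all the
    M^k.  An ideal P maximal among those containing J modulo which the powers of
    M do not stabilise is prime, and the local ring of A/P at phi is a
    one-dimensional domain, free of finite rank r over the ring of convergent
    power series in a parameter t = h/v with h in M and phi(v) <> 0: iterating a
    norm-controlled division with remainder by h gives the convergence.
    Multiplication by a is thus an analytic family X_t(a) of r x r matrices whose
    eigenvalues are the values at a of characters in H, equal to phi when t = 0.
    If these values never exceed |phi(a)| in modulus, the maximum principle for
    the trace of X_t(a) makes them all equal to phi(a).  Hence every face
    containing phi contains all the characters so obtained, which are therefore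
    equal to phi; but their value at h is t times their value at v. *)

Set Implicit Arguments.
Unset Strict Implicit.
Unset Printing Implicit Defensive.

Import Order.TTheory GRing.Theory Num.Theory.
Import numFieldNormedType.Exports.

Local Open Scope classical_set_scope.
Local Open Scope ring_scope.

(** * Moduli of complex numbers *)

Section Cabs.
Variable R : realType.
Implicit Types z w : R[i].

(** The norm of [R[i]] takes its values in [R[i]]; infima, real bounds and linear arithmetic call
    for a modulus with values in [R]. *)
Definition cabs z : R := complex.Re `|z|.

Lemma cabsE z : (cabs z)%:C%C = `|z|.
Proof. by rewrite /cabs RRe_real// ger0_real. Qed.

Lemma cabs_ge0 z : 0 <= cabs z.
Proof. by rewrite -ler0c cabsE. Qed.

Lemma cabsD z w : cabs (z + w) <= cabs z + cabs w.
Proof. by rewrite -lecR rmorphD/= !cabsE ler_normD. Qed.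

Lemma cabsM z w : cabs (z * w) = cabs z * cabs w.
Proof. by apply: complexI; rewrite rmorphM/= !cabsE normrM. Qed.

Lemma cabsN z : cabs (- z) = cabs z.
Proof. by rewrite /cabs normrN. Qed.

Lemma cabs0 : cabs 0 = 0.
Proof. by rewrite /cabs normr0. Qed.

Lemma cabs1 : cabs 1 = 1.
Proof. by rewrite /cabs normr1. Qed.

Lemma cabs_eq0 z : (cabs z == 0) = (z == 0).
Proof. by rewrite -(inj_eq (@complexI R)) cabsE normr_eq0. Qed.

Lemma cabs_gt0 z : (0 < cabs z) = (z != 0).
Proof. by rewrite lt_neqAle cabs_ge0 andbT eq_sym cabs_eq0. Qed.

Lemma cabsX z n : cabs (z ^+ n) = cabs z ^+ n.
Proof. by elim: n => [|n IH]; rewrite ?expr0 ?cabs1// !exprS cabsM IH. Qed.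

Lemma cabsV z : cabs z^-1 = (cabs z)^-1.
Proof.
have [->|z0] := eqVneq z 0; first by rewrite invr0 cabs0 invr0.
apply: (mulfI (x := cabs z)); first by rewrite cabs_eq0.
by rewrite -cabsM mulfV// cabs1 mulfV// cabs_eq0.
Qed.

Lemma cabsR (x : R) : 0 <= x -> cabs x%:C%C = x.
Proof. by move=> x0; rewrite /cabs ger0_norm// ler0c. Qed.

Lemma cabsB z w : cabs (z - w) = cabs (w - z).
Proof. by rewrite -cabsN opprB. Qed.

Lemma cabs_sum (I : Type) (r : seq I) (P : pred I) (F : I -> R[i]) :
  cabs (\sum_(i <- r | P i) F i) <= \sum_(i <- r | P i) cabs (F i).
Proof.
elim/big_rec2: _ => [|i x y _ H]; first by rewrite cabs0.
by apply: le_trans (cabsD _ _) _; rewrite lerD2l.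
Qed.

End Cabs.

(** * Compact discs and local bounds *)

Section Disc.
Variable R : realType.

Lemma nbhs_cabsP (z : R[i]) (U : set R[i]) :
  nbhs z U <-> exists2 r : R, 0 < r & forall w, cabs (z - w) < r -> U w.
Proof.
split.
  move=> /nbhs_ballP[e /= e0 eU]; exists (complex.Re e).
    by rewrite -ltcR; rewrite RRe_real// gtr0_real.
  move=> w zw; apply: eU; rewrite -ball_normE /=.
  by rewrite -cabsE -[e]RRe_real ?gtr0_real// ltcR.
move=> [r r0 rU]; apply/nbhs_ballP; exists r%:C%C => /=; first by rewrite ltcR.
by move=> w; rewrite -ball_normE /= -cabsE ltcR => /rU.
Qed.

Lemma cabs_ReIm (z : R[i]) : cabs z <= `|complex.Re z| + `|complex.Im z|.
Proof.
rewrite [z in leLHS]complexE; apply: le_trans (cabsD _ _) _; rewrite cabsM.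
have -> : cabs 'i%C = 1 :> R.
  by rewrite /cabs normc_def/= expr0n/= add0r expr1n sqrtr1.
rewrite mul1r; have E (x : R) : cabs x%:C%C = `|x|.
  by rewrite /cabs normc_def/= expr0n/= addr0 sqrtr_sqr.
by rewrite !E.
Qed.

Lemma Re_cabs (z : R[i]) : `|complex.Re z| <= cabs z.
Proof. by rewrite -lecR cabsE normc_ge_Re. Qed.

Lemma Im_cabs (z : R[i]) : `|complex.Im z| <= cabs z.
Proof.
have := Re_cabs (z * 'i%C); rewrite ReiNIm normrN.
rewrite cabsM; have -> : cabs 'i%C = 1 :> R.
  by rewrite /cabs normc_def/= expr0n/= add0r expr1n sqrtr1.
by rewrite mulr1.
Qed.

Lemma cabs_continuous : continuous (@cabs R).
Proof.
move=> z U /nbhs_ballP[e /= e0 eU]; apply/nbhs_cabsP; exists e => // w zw.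
apply: eU; rewrite -ball_normE /=.
rewrite (le_lt_trans _ zw)//; rewrite ler_norml; apply/andP; split.
  by rewrite lerNl opprB lerBlDr cabsB (le_trans _ (cabsD _ _))// subrK.
by rewrite lerBlDr (le_trans _ (cabsD _ _))// subrK.
Qed.

Lemma compact_disc (S : R) : compact [set z : R[i] | cabs z <= S].
Proof.
pose f (p : R * R) : R[i] := (p.1 +i* p.2)%C.
have cf : continuous f.
  move=> p U /nbhs_cabsP[r r0 rU].
  have r2 : 0 < r / 2 by rewrite divr_gt0.
  exists (ball p.1 (r / 2), ball p.2 (r / 2)) => /=.
    by split; exact: nbhsx_ballx.
  move=> [x y] /= [px py]; apply: rU.
  apply: le_lt_trans (cabs_ReIm _) _ => /=.
  by rewrite [ltRHS](splitr r) ltrD.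
have sq : compact (f @` (`[- S, S] `*` `[- S, S])).
  apply: continuous_compact.
    by apply/continuous_subspaceT => x; exact: cf.
  by apply: compact_setX; exact: segment_compact.
apply: (subclosed_compact _ sq).
  rewrite (_ : [set _ | _] = (@cabs R) @^-1` [set x | x <= S])//.
  by apply: closed_comp => [z _|]; [exact: cabs_continuous|exact: closed_le].
move=> z /= zS; exists (complex.Re z, complex.Im z); last by case: z {zS}.
by split; rewrite /= in_itv/= -ler_norml (le_trans _ zS)// ?Re_cabs ?Im_cabs.
Qed.

(** A local bound B stays valid when B grows, so compactness of the disc, applied with the filter of
    large B, yields a common one. *)
Lemma disc_bounded (f : R[i] -> R) (S : R) :
  (forall z, exists r B : R, 0 < r /\ forall w, cabs (z - w) < r -> f w <= B) ->
  exists B, forall z, cabs z <= S -> f z <= B.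
Proof.
move=> Hf; have /compact_near_coveringP := @compact_disc S.
move=> /(_ R +oo%R (fun B z => f z <= B) _) [].
  move=> z _; have [r [B [r0 HB]]] := Hf z.
  exists ([set w | cabs (z - w) < r], [set x | B <= x]) => /=.
    by split; [apply/nbhs_cabsP; exists r | by exists B; split; [exact: num_real | move=> x /ltW]].
  by move=> [w x] /= [/HB + ]; exact: le_trans.
move=> B [_ HB]; exists (B + 1) => z zS; apply: HB zS.
by rewrite ltrDl.
Qed.

End Disc.

Lemma half_pow_lt (R : realType) (x e : R) :
  0 < e -> exists n, x * 2^-1 ^+ n < e.
Proof.
move=> e0; have y0 : 0 <= `|x| / e by rewrite divr_ge0// ltW.
exists (Num.bound (`|x| / e)); set n := Num.bound _.
rewrite exprVn ltr_pdivrMr ?exprn_gt0// -ltr_pdivrMl// mulrC.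
apply: le_lt_trans (_ : `|x| / e < _).
  by rewrite ler_pM2r ?invr_gt0// ler_norm.
apply: lt_le_trans (archi_boundP y0) _.
by rewrite -natrX ler_nat ltnW// ltn_expl.
Qed.

(** * The Gelfand-Mazur theorem for a seminorm *)

Section GelfandMazur.
Variables (R : realType) (A : comAlgType R[i]) (q : A -> R).
Hypotheses (q_ge0 : forall a, 0 <= q a)
  (qD : forall a b, q (a + b) <= q a + q b)
  (qM : forall a b, q (a * b) <= q a * q b)
  (qZ : forall (k : R[i]) a, q (k *: a) = cabs k * q a).

Local Notation "a ~~ b" := (q (a - b) = 0) (at level 70).

Let q0 : q 0 = 0.
Proof. by rewrite -(scale0r (0 : A)) qZ cabs0 mul0r. Qed.

Let qN a : q (- a) = q a.
Proof. by rewrite -scaleN1r qZ cabsN cabs1 mul1r. Qed.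

Let qB a b : q (a - b) = q (b - a).
Proof. by rewrite -qN opprB. Qed.

Let q_congr a b : a ~~ b -> q a = q b.
Proof.
move=> ab; apply/le_anti/andP; split.
  by rewrite -[a](subrK b); apply: le_trans (qD _ _) _; rewrite ab add0r.
rewrite -[b](subrK a); apply: le_trans (qD _ _) _.
by rewrite qB ab add0r.
Qed.

Let q_zero a : q a <= 0 -> q a = 0.
Proof. by move=> ?; apply/le_anti; rewrite q_ge0 andbT. Qed.

Let q_zeroD a b : q a = 0 -> q b = 0 -> q (a + b) = 0.
Proof. by move=> a0 b0; apply: q_zero; rewrite (le_trans (qD _ _))// a0 b0 addr0. Qed.

Let q_zeroM a b : q b = 0 -> q (a * b) = 0.
Proof. by move=> b0; apply: q_zero; rewrite (le_trans (qM _ _))// b0 mulr0. Qed.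

Let qX a n : q (a ^+ n.+1) <= q a ^+ n.+1.
Proof.
elim: n => [|n IH]; first by rewrite !expr1.
rewrite exprS (le_trans (qM _ _))// [leRHS]exprS ler_wpM2l//.
Qed.

Let q_add0 a b : q b = 0 -> q (a + b) = q a.
Proof. by move=> b0; apply: q_congr; rewrite addrAC subrr add0r. Qed.

(* If every a - k were invertible, [G j s] below, the average over the 2^j-th
   roots of unity z of the inverses [F (z * s)] of 1 - zsa, would be an inverse
   of 1 - (sa)^(2^j).  The averages being equicontinuous, the property
   (sa)^(2^j) -> 0 propagates from s to s + d with a uniform step d, hence to
   all s, which contradicts the invertibility of a. *)
Lemma gelfand_mazur_seminorm a : 0 < q 1 ->
  exists k : R[i], forall b, q ((a - k%:A) * b - 1) != 0.
Proof.
move=> q1; apply: contrapT => /forallNP Hn.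
have inv (k : R[i]) : exists b, q ((a - k%:A) * b - 1) = 0.
  by have /existsNP[b /negP/negPn/eqP] := Hn k; exists b.
(* [F s] inverts 1 - sa up to q; for s <> 0 it is read off 1 - sa = -s(a - 1/s). *)
have /choice[F HF] : forall s : R[i], exists b, q ((1 - s *: a) * b - 1) = 0.
  move=> s; have [->|s0] := eqVneq s 0.
    by exists 1; rewrite scale0r subr0 mulr1 subrr q0.
  have [b Hb] := inv s^-1; exists (- s^-1 *: b).
  rewrite (_ : _ * _ = (a - s^-1%:A) * b)// -scalerAr scalerAl.
  congr (_ * _); rewrite scalerBr scalerA mulNr mulVf// scaleN1r opprK.
  by rewrite scaleNr addrC.
(* Resolvent identity: F(s) - F(t) = (s - t) a F(s) F(t) modulo the null space of q. *)
have FB s t : q (F s - F t) <= cabs (s - t) * (q a * (q (F s) * q (F t))).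
  have -> : F s - F t = (s - t) *: (a * (F s * F t)) +
      (((1 - s *: a) * F s - 1) * F t - ((1 - t *: a) * F t - 1) * F s).
    rewrite scalerAl scalerBl; set x := s *: a; set y := t *: a; ring.
  rewrite q_add0; last first.
    apply: q_zeroD; first by rewrite mulrC q_zeroM.
    by rewrite qN mulrC q_zeroM.
  rewrite qZ ler_wpM2l ?cabs_ge0// (le_trans (qM _ _))// ler_wpM2l//.
(* Within this radius the resolvent identity gives q(F w - F z) <= q(F w) / 2, hence q(F w) <= 2 q(F
   z). *)
have FL z : exists r B : R, 0 < r /\ forall w, cabs (z - w) < r -> q (F w) <= B.
  pose m := q a * q (F z).
  have m0 : 0 <= m by rewrite mulr_ge0.
  exists (2 * (m + 1))^-1, (2 * q (F z)); split.
    by rewrite invr_gt0; lra.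
  move=> w zw; have := FB w z; rewrite cabsB => H.
  have Fw : q (F w) <= q (F z) + q (F w - F z).
    by rewrite -{1}[F w](subrK (F z)) addrC qD.
  have zw' : cabs (z - w) * (2 * (m + 1)) <= 1.
    by rewrite -ler_pdivlMr ?mul1r 1?ltW//; lra.
  have Fw0 := q_ge0 (F w); have zw0 := cabs_ge0 (z - w).
  have : cabs (z - w) * (q a * (q (F w) * q (F z))) <= q (F w) / 2.
    rewrite (_ : _ * _ = (cabs (z - w) * m) * q (F w)); last by rewrite /m; ring.
    by rewrite mulrC ler_wpM2l//; nra.
  by lra.
have [c Hc] := inv 0; rewrite scale0r subr0 in Hc.
(* Here c inverts a up to q; S exceeds q(c) so that the powers of S^-1 c stay in the unit ball once
   s has reached S. *)
pose S := q c + 1; have S0 : 0 < S by rewrite /S ltr_wpDl.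
have [B0 HB0] := disc_bounded S FL.
pose B := B0 + `|B0| + 1; have B1 : 1 <= B.
  by rewrite /B lerDr -lerBlDl sub0r -normrN ler_norm.
have HB z : cabs z <= S -> q (F z) <= B.
  by move=> /HB0 h; apply: le_trans h _; rewrite /B -addrA lerDl addr_ge0.
(* Replacing s by zeta s changes the sign of x = (sa)^(2^j), and (1 - x^2)^-1 is the average of (1 -
   x)^-1 and (1 + x)^-1. *)
have zeta j : {z : R[i] | z ^+ (2 ^ j) = -1 & cabs z = 1}.
  have z1 : ((2 ^ j).-root (-1 : R[i])) ^+ (2 ^ j) = -1.
    by rewrite rootCK// expn_gt0.
  exists ((2 ^ j).-root (-1)) => //.
  apply/eqP; rewrite -(@pexpr_eq1 _ _ (2 ^ j)) ?cabs_ge0 ?expn_gt0//.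
  by rewrite -cabsX z1 cabsN cabs1.
pose G := fix G j : R[i] -> A := if j is j'.+1 then
  fun s => (2^-1 : R[i]) *: (G j' s + G j' (s2val (zeta j') * s)) else F.
have G1 j s : q ((1 - (s *: a) ^+ (2 ^ j)) * G j s - 1) = 0.
  elim: j s => [|j IH] s /=; first by rewrite expn0 expr1 HF.
  have IH1 := IH s; have IH2 := IH (s2val (zeta j) * s); move: IH1 IH2.
  rewrite -scalerA [(s2val _ *: _) ^+ _]exprZn (s2valP (zeta j)) scaleN1r opprK.
  rewrite expnSr exprM; set x := _ ^+ _; set g := G j s; set g' := G j _.
  move=> h1 h2; have E : 1 = 2^-1 *: (1 + 1 : A).
    by rewrite scalerDr -scalerDl -[X in X + X]div1r -splitr scale1r.
  rewrite -scalerAr [X in _ - X]E -scalerBr qZ; apply/eqP.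
  rewrite mulf_eq0; apply/orP; right; apply/eqP.
  have -> : (1 - x ^+ 2) * (g + g') - (1 + 1) =
    (1 + x) * ((1 - x) * g - 1) + (1 - x) * ((1 + x) * g' - 1) by ring.
  by apply: q_zeroD; rewrite q_zeroM.
have zS j s : cabs (s2val (zeta j) * s) = cabs s.
  by rewrite cabsM (s2valP' (zeta j)) mul1r.
have half2 : cabs (2^-1 : R[i]) = 2^-1.
  by rewrite cabsV (_ : 2 = 2%:R%:C%C) ?cabsR// rmorph_nat.
have G2 j s : cabs s <= S -> q (G j s) <= B.
  elim: j s => [|j IH] s sS /=; first exact: HB.
  rewrite qZ half2 ler_pdivrMl// mulrDl mul1r (le_trans (qD _ _))// lerD ?IH//.
  by rewrite zS.
pose L := q a * (B * B).
have L0 : 0 <= L by rewrite /L !mulr_ge0//; lra.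
have G3 j s t : cabs s <= S -> cabs t <= S ->
    q (G j s - G j t) <= L * cabs (s - t).
  elim: j s t => [|j IH] s t sS tS /=.
    rewrite (le_trans (FB _ _))// mulrC ler_wpM2r ?cabs_ge0// /L ler_wpM2l//.
    by rewrite ler_pM// HB.
  rewrite -scalerBr qZ half2 ler_pdivrMl// mulrDl mul1r opprD addrACA.
  rewrite (le_trans (qD _ _))// lerD ?IH//.
  by rewrite -(zS j (s - t)) mulrBr IH// zS.
pose good s := exists N, q ((s *: a) ^+ (2 ^ N)) <= 2^-1.
have goodE s : good s -> exists N, forall i,
    q ((s *: a) ^+ (2 ^ (N + i))) <= 2^-1 ^+ i.+1.
  move=> [N HN]; exists N; elim=> [|i IH]; first by rewrite addn0 expr1.
  rewrite addnS expnSr exprM (le_trans (qX _ 1))//=.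
  apply: le_trans (_ : (2^-1 ^+ i.+1) ^+ 2 <= _).
    by rewrite lerXn2r// ?nnegrE ?exprn_ge0.
  rewrite -exprM ler_wiXn2l// ?invf_le1// ?ler1n//.
  by rewrite muln2 doubleS !ltnS -addnn leq_addr.
(* The inverse at r is within 1/12 of 1 and the Lipschitz bound adds 1/4, so the inverse g at r + d
   is within 1/3 of 1. As y = (g - 1) - y(g - 1) up to q, it follows that q(y) <= 1/3 + q(y)/3, thus
   q(y) <= 1/2. *)
have step (r d : R) : 0 <= r -> 0 <= d -> r + d <= S -> L * d <= 4^-1 ->
    good r%:C%C -> good (r + d)%:C%C.
  move=> r0 d0 rdS Ld /goodE[N HN].
  have [i Hi] : exists i, B * 2^-1 ^+ i < 12^-1.
    by apply: half_pow_lt; rewrite invr_gt0.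
  exists (N + i)%N; set y := _ ^+ _.
  have := G1 (N + i)%N r%:C%C; have := G1 (N + i)%N (r + d)%:C%C; rewrite -/y.
  set x := (r%:C%C *: a) ^+ _; have xi : q x <= 2^-1 ^+ i.+1 by exact: HN.
  have rS : cabs r%:C%C <= S by rewrite cabsR//; lra.
  have rdS' : cabs (r + d)%:C%C <= S by rewrite cabsR//; lra.
  have := G2 (N + i)%N _ rS; have := G3 (N + i)%N _ _ rdS' rS.
  set g := G _ _; set g' := G _ _; rewrite -rmorphB/= addrAC subrr add0r.
  rewrite cabsR// => gg' g'B h h'.
  have g'1 : q (g' - 1) <= 12^-1.
    have -> : g' - 1 = x * g' + ((1 - x) * g' - 1) by ring.
    rewrite q_add0// (le_trans (qM _ _))//.
    apply: le_trans (ltW Hi); rewrite mulrC ler_pM// (le_trans xi)//.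
    by rewrite ler_wiXn2l// ?invf_le1// ?ler1n.
  have g1 : q (g - 1) <= 3^-1.
    rewrite -(subrK g' g) -addrA (le_trans (qD _ _))//; lra.
  have : q y <= q (g - 1) + q y * q (g - 1).
    rewrite {1}(_ : y = (g - 1) - y * (g - 1) + - ((1 - y) * g - 1)); last by ring.
    rewrite q_add0 ?qN// (le_trans (qD _ _))// lerD2l qN; exact: qM.
  have h1 : q y * q (g - 1) <= q y * 3^-1 by rewrite ler_wpM2l.
  have h3 := q_ge0 y; lra.
have [m Hm] : exists m : nat, L * S < 4^-1 * m.+1%:R.
  have LS0 : 0 <= L * S * 4 by exact: mulr_ge0 (mulr_ge0 L0 (ltW S0)) (ler0n _ 4).
  have := archi_boundP LS0; set m := Num.bound _ => hm; exists m.
  by rewrite [ltRHS]mulrC ltr_pdivlMr// (lt_le_trans hm)// ler_nat.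
have goodm k : (k <= m.+1)%N -> good (k%:R * (S / m.+1%:R))%:C%C.
  elim: k => [|k IH] km.
    exists 0%N; rewrite mul0r scale0r expn0 expr1 q0 invr_ge0//.
  rewrite -addn1 natrD mulrDl mul1r; apply: step.
  - by rewrite mulr_ge0// divr_ge0// ltW.
  - by rewrite divr_ge0// ltW.
  - rewrite -[X in _ + X]mul1r -mulrDl natr1 mulrCA ger_pMr// ler_pdivrMr// mul1r.
    by rewrite ler_nat.
  - by rewrite mulrA ler_pdivrMr// ltW.
  - by apply: IH; rewrite ltnW.
have /goodE[N HN] : good S%:C%C.
  by have := goodm _ (leqnn _); rewrite mulrC divfK.
have [i Hi] : exists i, 1 * 2^-1 ^+ i < q 1 by exact: half_pow_lt.
have := HN i; set n := (2 ^ _)%N => Hn'.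
have n0 : n = n.-1.+1 by rewrite prednK// expn_gt0.
have : q 1 <= 2^-1 ^+ i.+1 * 1.
  rewrite (q_congr (b := (S%:C%C *: a) ^+ n * (S^-1%:C%C *: c) ^+ n)).
    rewrite (le_trans (qM _ _))// ler_pM// n0 (le_trans (qX _ _))//.
    apply: exprn_ile1 => //; rewrite qZ cabsR; last by rewrite invr_ge0 ltW.
    by rewrite ler_pdivrMl// mulr1 /S lerDl.
  rewrite -exprMn -scalerAl -scalerAr scalerA -rmorphM/= divff ?gt_eqF//.
  rewrite scale1r qB subrX1 mulrC q_zeroM//.
have : 2^-1 ^+ i.+1 <= 2^-1 ^+ i :> R by rewrite ler_wiXn2l// ?invf_le1// ?ler1n.
lra.
Qed.

End GelfandMazur.

(** * Ideals and characters *)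

Section IdealTheory.
Variable A : comNzRingType.
Implicit Types (I J Q : set A) (a b : A).

Lemma ideal0 I : is_ideal I -> I 0. Proof. by case. Qed.

Lemma idealD I a b : is_ideal I -> I a -> I b -> I (a + b).
Proof. by case=> _ h _; exact: h. Qed.

Lemma ideal_mull I a b : is_ideal I -> I b -> I (a * b).
Proof. by case=> _ _; exact. Qed.

Lemma ideal_mulr I a b : is_ideal I -> I a -> I (a * b).
Proof. by move=> hI Ia; rewrite mulrC; exact: ideal_mull. Qed.

Lemma idealN I a : is_ideal I -> I a -> I (- a).
Proof. by move=> hI Ia; rewrite -mulN1r; exact: ideal_mull. Qed.

Lemma idealB I a b : is_ideal I -> I a -> I b -> I (a - b).
Proof. by move=> hI Ia Ib; apply: idealD => //; exact: idealN. Qed.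

Lemma ideal_sum (T : Type) (r : seq T) (P : pred T) (F : T -> A) I :
  is_ideal I -> (forall i, P i -> I (F i)) -> I (\sum_(i <- r | P i) F i).
Proof.
move=> hI; elim/big_ind: _ => [_|x y hx hy h|i Pi h]; last exact: h.
  exact: ideal0.
by apply: idealD => //; [exact: hx | exact: hy].
Qed.

Definition idsum I J : set A := [set a | exists2 x, I x & J (a - x)].

Definition idmul I w : set A := [set a | exists2 x, I x & a = x * w].

Lemma idmul_ideal I w : is_ideal I -> is_ideal (idmul I w).
Proof.
move=> hI; split.
- by exists 0; rewrite ?mul0r//; exact: ideal0.
- by move=> _ _ [x Ix ->] [y Iy ->]; exists (x + y); rewrite ?mulrDl//; exact: idealD.
- by move=> a _ [x Ix ->]; exists (a * x); rewrite ?mulrA//; exact: ideal_mull.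
Qed.

Lemma idsum_ideal I J : is_ideal I -> is_ideal J -> is_ideal (idsum I J).
Proof.
move=> hI hJ; split.
- by exists 0; rewrite ?subrr//; exact: ideal0.
- move=> a b [x Ix ax] [y Iy by_]; exists (x + y); first exact: idealD.
  by rewrite opprD addrACA; exact: idealD.
- move=> a b [x Ix bx]; exists (a * x); first exact: ideal_mull.
  by rewrite -mulrBr; exact: ideal_mull.
Qed.

Lemma idsuml I J a : is_ideal J -> I a -> idsum I J a.
Proof. by move=> hJ Ia; exists a => //; rewrite subrr; exact: ideal0. Qed.

Lemma idsumr I J a : is_ideal I -> J a -> idsum I J a.
Proof. by move=> hI Ja; exists 0; rewrite ?subr0//; exact: ideal0. Qed.

Lemma setT_ideal : is_ideal [set: A]. Proof. by []. Qed.

Lemma set0_ideal : is_ideal [set 0 : A].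
Proof. by split => //= [_ _ -> ->|a _ ->]; rewrite ?addr0 ?mulr0. Qed.

Definition principal w : set A := idmul setT w.

Lemma principal_ideal w : is_ideal (principal w).
Proof. exact: idmul_ideal setT_ideal. Qed.

Lemma principal_id w : principal w w.
Proof. by exists 1; rewrite ?mul1r. Qed.

Lemma ideal_zorn (Q : set A -> Prop) I : is_ideal I -> Q I ->
  (forall F : set (set A), F !=set0 -> total_on F subset ->
     (forall X, F X -> [/\ is_ideal X, Q X & I `<=` X]) ->
     Q (\bigcup_(X in F) X)) ->
  exists M, [/\ is_ideal M, Q M, I `<=` M &
    forall J, is_ideal J -> M `<=` J -> Q J -> J `<=` M].
Proof.
move=> hI QI chainQ.
pose P X := X = set0 \/ [/\ is_ideal X, Q X & I `<=` X].
have [F FP totF|M [PM maxM]] := @Zorn_bigcup A P.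
  pose G := F `&` [set X | X !=set0].
  have EG : \bigcup_(X in F) X = \bigcup_(X in G) X.
    apply/seteqP; split=> [a [X FX Xa]|a [X [FX _] Xa]]; exists X => //.
    by split => //; exists a.
  have [[X0 GX0]|G0] := pselect (G !=set0); last first.
    left; rewrite EG; apply/seteqP; split=> // a [X GX _].
    by case: G0; exists X.
  right; have GP X : G X -> [/\ is_ideal X, Q X & I `<=` X].
    by move=> [/FP h [a Xa]]; case: h Xa => // ->.
  have totG : total_on G subset by move=> X Y [FX _] [FY _]; exact: totF.
  rewrite EG; split; first 1 last.
  - by apply: chainQ => //; exists X0.
  - by move=> a Ia; exists X0 => //; have [_ _] := GP _ GX0; exact.
  split.
  - by exists X0 => //; have [h _ _] := GP _ GX0; exact: ideal0.
  - move=> a b [X GX Xa] [Y GY Yb].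
    have [XY|YX] := totG _ _ GX GY.
      by exists Y => //; apply: idealD => //; [have [] := GP _ GY | exact: XY].
    by exists X => //; apply: idealD => //; [have [] := GP _ GX | exact: YX].
  - move=> a b [X GX Xb]; exists X => //.
    by apply: ideal_mull => //; have [] := GP _ GX.
have {}PM : [/\ is_ideal M, Q M & I `<=` M].
  case: PM => // M0; exfalso; apply: (maxM I); last by right; split.
  by rewrite M0; split => // /(_ 0); apply; exact: ideal0.
case: PM => hM QM IM; exists M; split => // J hJ MJ QJ.
apply: contrapT => nJM; apply: (maxM J); first by split.
by right; split => //; exact: subset_trans IM MJ.
Qed.

Lemma not_in_maximal (M : set A) a : is_ideal M -> ~ M a ->
  (forall J, is_ideal J -> M `<=` J -> ~ J 1 -> J `<=` M) ->
  exists b, M (1 - b * a).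
Proof.
move=> hM Ma maxM; pose J := idsum (principal a) M.
have hJ : is_ideal J by apply: idsum_ideal => //; exact: principal_ideal.
have [[_ [b _ ->]]|J1] := pselect (J 1); first by exists b.
exfalso; apply: Ma; apply: (maxM J) => //.
  by move=> x Mx; apply: idsumr => //; exact: principal_ideal.
by apply: idsuml => //; exact: principal_id.
Qed.

End IdealTheory.

(* [nm_complete] is completeness, stated for geometric sequences only. *)
Record banach_norm (R : realType) (A : comAlgType R[i]) (nm : A -> R) : Prop :=
  BanachNorm {
    nm_ge0 : forall a, 0 <= nm a;
    nmD : forall a b, nm (a + b) <= nm a + nm b;
    nmM : forall a b, nm (a * b) <= nm a * nm b;
    nmZ : forall (k : R[i]) a, nm (k *: a) = cabs k * nm a;
    nm0_eq0 : forall a, nm a = 0 -> a = 0;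
    nm_complete : forall (u : nat -> A) B,
      (forall k, nm (u k.+1 - u k) <= B * 2^-1 ^+ k) ->
      exists l, forall k, nm (l - u k) <= 2 * B * 2^-1 ^+ k }.

(** The conditions defining [characters], for an algebra without topology: the algebraic part works
    with an abstract [banach_norm]. *)
Definition is_character (R : realType) (A : comAlgType R[i]) (chi : A -> R[i]) :=
  [/\ scalar chi, {morph chi : a b / a * b} & exists a, chi a != 0].

Section Characters.
Variables (R : realType) (A : comAlgType R[i]).
Variable chi : A -> R[i].
Hypothesis hchi : is_character chi.

Lemma char_lin k a b : chi (k *: a + b) = k * chi a + chi b.
Proof. by case: hchi => h _ _; exact: h. Qed.

Lemma charM a b : chi (a * b) = chi a * chi b.
Proof. by case: hchi => _ h _; exact: h. Qed.

Lemma charD a b : chi (a + b) = chi a + chi b.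
Proof. by rewrite -[a]scale1r char_lin mul1r scale1r. Qed.

Lemma char0 : chi 0 = 0.
Proof. by apply: (@addIr _ (chi 0)); rewrite -charD !add0r. Qed.

Lemma charZ k a : chi (k *: a) = k * chi a.
Proof. by rewrite -[_ *: _]addr0 char_lin char0 addr0. Qed.

Lemma charN a : chi (- a) = - chi a.
Proof. by rewrite -scaleN1r charZ mulN1r. Qed.

Lemma charB a b : chi (a - b) = chi a - chi b.
Proof. by rewrite charD charN. Qed.

Lemma char1 : chi 1 = 1.
Proof.
case: hchi => _ _ [a a0]; apply: (mulfI a0).
by rewrite -charM !mulr1.
Qed.

Lemma char_alg k : chi k%:A = k.
Proof. by rewrite charZ char1 mulr1. Qed.

Lemma charX a n : chi (a ^+ n) = chi a ^+ n.
Proof. by elim: n => [|n IH]; rewrite ?expr0 ?char1// !exprS charM IH. Qed.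

Lemma char_sum (I : Type) (r : seq I) (P : pred I) (F : I -> A) :
  chi (\sum_(i <- r | P i) F i) = \sum_(i <- r | P i) chi (F i).
Proof. exact: (big_morph chi charD char0). Qed.

End Characters.

Section BanachNormTheory.
Variables (R : realType) (A : comAlgType R[i]) (nm : A -> R).
Hypothesis hnm : banach_norm nm.
Local Notation nm_ge0 := (nm_ge0 hnm).
Local Notation nmD := (nmD hnm).
Local Notation nmM := (nmM hnm).
Local Notation nmZ := (nmZ hnm).

Lemma nm0 : nm 0 = 0.
Proof. by rewrite -(scale0r (0 : A)) nmZ cabs0 mul0r. Qed.

Lemma nmN a : nm (- a) = nm a.
Proof. by rewrite -scaleN1r nmZ cabsN cabs1 mul1r. Qed.

Lemma nmB a b : nm (a - b) <= nm a + nm b.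
Proof. by rewrite -(nmN b) nmD. Qed.

Lemma nm_sum (I : Type) (r : seq I) (P : pred I) (F : I -> A) :
  nm (\sum_(i <- r | P i) F i) <= \sum_(i <- r | P i) nm (F i).
Proof.
elim/big_rec2: _ => [|i x y _ H]; first by rewrite nm0.
by apply: le_trans (nmD _ _) _; rewrite lerD2l.
Qed.

Lemma half_pow_le0 (x B : R) : (forall k, x <= B * 2^-1 ^+ k) -> x <= 0.
Proof.
move=> H; rewrite leNgt; apply/negP => x0.
by have [n] := half_pow_lt B x0; rewrite ltNge H.
Qed.

Lemma nm_half_eq0 a B : (forall k, nm a <= B * 2^-1 ^+ k) -> a = 0.
Proof.
move=> H; apply: (nm0_eq0 hnm); apply/le_anti; rewrite nm_ge0 andbT.
exact: half_pow_le0 H.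
Qed.

Lemma nmX_half a k : nm a <= 2^-1 -> nm (a ^+ k) <= nm 1 * 2^-1 ^+ k.
Proof.
move=> a2; elim: k => [|k IH]; first by rewrite !expr0 mulr1.
by rewrite exprS (le_trans (nmM _ _))// exprS mulrCA ler_pM ?nm_ge0.
Qed.

Lemma neumann x : nm x <= 2^-1 -> exists y, (1 - x) * y = 1.
Proof.
move=> x2; pose u k := \sum_(i < k) x ^+ i.
have [k|l Hl] := nm_complete hnm (u := u) (B := nm 1).
  by rewrite /u big_ord_recr/= addrAC subrr add0r nmX_half.
exists l; apply/eqP; rewrite -subr_eq0; apply/eqP.
apply: (@nm_half_eq0 _ (nm (1 - x) * (2 * nm 1) + nm 1)) => k.
have -> : (1 - x) * l - 1 = (1 - x) * (l - u k) - x ^+ k.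
  rewrite mulrBr; have -> : (1 - x) * u k = 1 - x ^+ k.
    by rewrite -opprB mulNr -subrX1 opprB.
  by ring.
rewrite (le_trans (nmB _ _))// [leRHS]mulrDl lerD ?nmX_half//.
by rewrite (le_trans (nmM _ _))// -mulrA ler_wpM2l ?nm_ge0.
Qed.

(* The optimal constant is 1; 2 comes from using Neumann series of ratio 1/2. *)
Lemma char_bound chi a : is_character chi -> cabs (chi a) <= 2 * nm a.
Proof.
move=> hchi; rewrite leNgt; apply/negP => lt_a.
have c0 : 0 < cabs (chi a) by rewrite (le_lt_trans _ lt_a)// mulr_ge0// nm_ge0.
have [|y Hy] := @neumann ((chi a)^-1 *: a).
  by rewrite nmZ cabsV ler_pdivrMl// ltW// ltr_pdivlMr// mulrC.
move: c0; rewrite cabs_gt0 => c0.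
have := congr1 chi Hy; rewrite charM// charB// charZ// mulVf// char1// subrr mul0r.
by move/eqP; rewrite eq_sym oner_eq0.
Qed.

(** * The character attached to a maximal ideal *)

Section MaximalIdeal.
Variable M : set A.
Hypotheses (hM : is_ideal M) (M1 : ~ M 1)
  (maxM : forall J, is_ideal J -> M `<=` J -> ~ J 1 -> J `<=` M).

(** The distance q to M is the seminorm of the quotient by M, used in place of the quotient
    algebra. *)
Let D a := [set nm (a - m) | m in M].
Let q a := inf (D a).

Let D_inf a : has_inf (D a).
Proof.
split; first by exists (nm (a - 0)), 0 => //; exact: ideal0.
by exists 0 => _ [m _ <-]; exact: nm_ge0.
Qed.

Let q_le a m : M m -> q a <= nm (a - m).
Proof. by move=> Mm; apply: ge_inf; [have [] := D_inf a | exists m]. Qed.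

Let q_lt a x : q a < x -> exists2 m, M m & nm (a - m) < x.
Proof. by move=> /(inf_lt (proj1 (D_inf a)))[_ [m Mm <-] ?]; exists m. Qed.

Let q_ge a x : (forall m, M m -> x <= nm (a - m)) -> x <= q a.
Proof.
move=> H; apply: lb_le_inf; first by have [] := D_inf a.
by move=> _ [m Mm <-]; exact: H.
Qed.

Let q_ge0 a : 0 <= q a. Proof. by apply: q_ge => m _; exact: nm_ge0. Qed.

Let qD a b : q (a + b) <= q a + q b.
Proof.
rewrite -lerBlDr; apply: q_ge => m Mm; rewrite lerBlDr [leRHS]addrC -lerBlDr.
apply: q_ge => m' Mm'; rewrite lerBlDr.
apply: le_trans (q_le _ (idealD hM Mm Mm')) _.
by rewrite opprD addrACA [leRHS]addrC nmD.
Qed.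

Let qM a b : q (a * b) <= q a * q b.
Proof.
rewrite leNgt; apply/negP => lt_ab.
(* A margin d such that representatives of a and b of norm below q(a) + d and q(b) + d have a
   product of norm below q(ab), which is absurd. *)
have [d [d0 Hd]] : exists d, 0 < d /\ (q a + d) * (q b + d) <= q (a * b).
  have s0 : 0 < q a + q b + 1 by rewrite ltr_wpDl// addr_ge0.
  pose e := q (a * b) - q a * q b; have e0 : 0 < e by rewrite subr_gt0.
  exists (Num.min 1 (e / (q a + q b + 1))).
  have d0 : 0 < Num.min 1 (e / (q a + q b + 1)).
    by rewrite lt_min ltr01 divr_gt0.
  split => //; move: d0; set d := Num.min _ _ => d0.
  have d1 : d <= 1 by rewrite ge_min lexx.
  have dd : d * (q a + q b + 1) <= e.
    by rewrite -ler_pdivlMr// ge_min lexx orbT.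
  have : d * d <= d by rewrite ger_pMr.
  by rewrite /e in dd; lra.
have [|m Mm am] := @q_lt a (q a + d); first by rewrite ltrDl.
have [|m' Mm' bm] := @q_lt b (q b + d); first by rewrite ltrDl.
have Mn : M (a * m' + b * m - m * m').
  by apply: idealB; rewrite //; [apply: idealD|]; rewrite //; exact: ideal_mull.
have := q_le (a * b) Mn.
rewrite (_ : _ - (_ - _) = (a - m) * (b - m')); last by ring.
apply/negP; rewrite -ltNge (le_lt_trans (nmM _ _))// (lt_le_trans _ Hd)//.
by rewrite ltr_pM ?nm_ge0.
Qed.

Let qZ_le (k : R[i]) a : k != 0 -> cabs k * q a <= q (k *: a).
Proof.
move=> k0; apply: q_ge => m Mm; have c0 : 0 < cabs k by rewrite cabs_gt0.
rewrite -ler_pdivlMl// -cabsV -nmZ scalerBr scalerA mulVf// scale1r.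
by apply: q_le; rewrite -mulr_algl; exact: ideal_mull.
Qed.

Let qZ (k : R[i]) a : q (k *: a) = cabs k * q a.
Proof.
have [->|k0] := eqVneq k 0.
  rewrite scale0r cabs0 mul0r; apply/le_anti; rewrite q_ge0 andbT.
  by rewrite -[leRHS]nm0 -[X in nm X](subr0 0) q_le//; exact: ideal0.
apply/le_anti; rewrite qZ_le// andbT.
have c0 : 0 < cabs k by rewrite cabs_gt0.
rewrite -ler_pdivrMl// -cabsV (le_trans (qZ_le _ _)) ?invr_eq0//.
by rewrite scalerA mulVf// scale1r.
Qed.

Let q_in a : M a -> q a = 0.
Proof.
move=> Ma; apply/le_anti; rewrite q_ge0 andbT.
by rewrite (le_trans (q_le a Ma))// subrr nm0.
Qed.

(** M is closed: if 1 - ba is in M and m in M is close to a, then 1 - b(a - m) is in M and is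
    invertible by a Neumann series. *)
Let q_eq0 a : q a = 0 -> M a.
Proof.
move=> a0; apply: contrapT => Ma; have [b Mb] := not_in_maximal hM Ma maxM.
have [|m Mm am] := @q_lt a (2 * (nm b + 1))^-1.
  by rewrite a0 invr_gt0 mulr_gt0// ltr_wpDl// nm_ge0.
have [|y Hy] := @neumann (b * (a - m)).
  rewrite (le_trans (nmM _ _))//; have := nm_ge0 b; move: am.
  rewrite -[_^-1]mul1r ltr_pdivlMr; last by rewrite mulr_gt0// ltr_wpDl// nm_ge0.
  by have := nm_ge0 (a - m); nra.
apply: M1; rewrite -Hy; apply: ideal_mulr => //.
rewrite mulrBr opprB addrCA; apply: idealD => //; exact: ideal_mull.
Qed.

(** The Gelfand-Mazur scalar k makes a - k non-invertible up to q; outside M it would be invertible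
    modulo M, on which q vanishes. *)
Lemma maximal_ideal_scalar a : exists k : R[i], M (a - k%:A).
Proof.
have q1 : 0 < q 1.
  by rewrite lt_neqAle q_ge0 andbT; apply/eqP => /esym /q_eq0.
have [k Hk] := gelfand_mazur_seminorm q_ge0 qD qM qZ a q1.
exists k; apply: contrapT => /(not_in_maximal hM)/(_ maxM)[b Mb].
have /eqP := Hk b; apply; apply: q_in; rewrite mulrC -opprB; exact: idealN.
Qed.

Lemma maximal_ideal_character :
  exists2 chi, is_character chi & forall a, M a -> chi a = 0.
Proof.
have /choice[chi Hchi] := maximal_ideal_scalar.
have uniq a k : M (a - k%:A) -> chi a = k.
  move=> Mk; apply: contrapT => /eqP; rewrite -subr_eq0 => nk.
  apply: M1; have : M ((chi a - k) *: 1).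
    rewrite scalerBl (_ : _ - _ = (a - k%:A) - (a - (chi a)%:A)).
      exact: idealB.
    by move: (k%:A) ((chi a)%:A) => x y; ring.
  move=> /(ideal_mull ((chi a - k)^-1%:A) hM).
  by rewrite mulr_algl scalerA mulVf// scale1r.
exists chi; last by move=> a Ma; apply: uniq; rewrite scale0r subr0.
split.
- move=> k a b; apply: uniq; rewrite scalerDl -scalerA.
  rewrite (_ : _ - _ = k%:A * (a - (chi a)%:A) + (b - (chi b)%:A)).
    by apply: idealD => //; exact: ideal_mull.
  by rewrite mulr_algl scalerBr opprD addrACA.
- move=> a b; apply: uniq.
  rewrite (_ : _ - _ = b * (a - (chi a)%:A) + (chi a)%:A * (b - (chi b)%:A)).
    by apply: idealD => //; exact: ideal_mull.
  rewrite -scalerA -[(chi b)%:A]mul1r scalerAl; ring.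
- exists 1; rewrite (@uniq 1 1) ?oner_eq0// scale1r subrr; exact: ideal0.
Qed.

End MaximalIdeal.

Lemma ideal_character (I : set A) : is_ideal I -> ~ I 1 ->
  exists2 chi, is_character chi & forall a, I a -> chi a = 0.
Proof.
move=> hI I1; have [|M [hM M1 IM maxM]] := @ideal_zorn A (fun J => ~ J 1) I hI I1.
  by move=> F _ _ HF [X FX X1]; have [_] := HF _ FX.
have [chi hchi Hchi] := maximal_ideal_character hM M1 maxM.
by exists chi => // a /IM; exact: Hchi.
Qed.

End BanachNormTheory.

(** * Powers of a finitely generated maximal ideal *)

Section Nakayama.
Variable A : comNzRingType.
Implicit Types (J Q : set A) (ws : seq A).

(** This is J w_1 + ... + J w_n + Q. The recursion on the list lets Nakayama's lemma eliminate the
    generators one at a time. *)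
Definition span_over J Q ws : set A :=
  foldr (fun w S => idsum (idmul J w) S) Q ws.

Lemma span_ideal J Q ws : is_ideal J -> is_ideal Q -> is_ideal (span_over J Q ws).
Proof.
by move=> hJ hQ; elim: ws => //= w ws IH; apply: idsum_ideal => //; exact: idmul_ideal.
Qed.

Lemma span_sum J Q (T : Type) (r : seq T) (w m : T -> A) a :
  (forall j, J (m j)) -> Q (a - \sum_(j <- r) m j * w j) ->
  span_over J Q [seq w j | j <- r] a.
Proof.
move=> Jm; elim: r a => [|j r IH] a /=; first by rewrite big_nil subr0.
rewrite big_cons opprD addrA => /IH; exists (m j * w j) => //.
by exists (m j).
Qed.

Lemma span_mul J Q ws v a : is_ideal J -> is_ideal Q ->
  (forall w, w \in ws -> Q (v * w)) -> span_over J Q ws a -> Q (v * a).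
Proof.
move=> hJ hQ; elim: ws a => [|w ws IH] a Hw /=; first exact: ideal_mull.
move=> [_ [x Jx ->]] /IH h.
rewrite -(subrK (x * w) a) mulrDr; apply: idealD => //.
  by apply: h => y yws; apply: Hw; rewrite inE yws orbT.
by rewrite mulrCA; apply: ideal_mull => //; apply: Hw; rewrite inE eqxx.
Qed.

Lemma span_mem J Q ws w c : is_ideal J -> is_ideal Q -> J c -> w \in ws ->
  span_over J Q ws (c * w).
Proof.
move=> hJ hQ Jc; elim: ws => // y ws IH; rewrite inE => /orP[/eqP ->|/IH h] /=.
  by apply: idsuml; [exact: span_ideal | exists c].
by apply: idsumr => //; exact: idmul_ideal.
Qed.

(** The relation for w_0 puts (1 - j_0) w_0 in the span of the other generators. Multiplying the
    relation of another w by 1 - j_0 then removes w_0 from it, and w is recovered by adding j_0 w.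
    Nothing is inverted; the factors 1 - j_0 accumulate in 1 - r. *)
Lemma nakayama J Q ws : is_ideal J -> is_ideal Q ->
  (forall w, w \in ws -> span_over J Q ws w) ->
  exists2 r, J r & forall w, w \in ws -> Q ((1 - r) * w).
Proof.
move=> hJ hQ; elim: ws => [|w0 ws IH] Hws; first by exists 0 => //; exact: ideal0.
have hZ : is_ideal (span_over J Q ws) by exact: span_ideal.
have [_ [j0 Jj0 ->] Z0] : span_over J Q (w0 :: ws) w0.
  by apply: Hws; rewrite inE eqxx.
have {}Z0 : span_over J Q ws ((1 - j0) * w0) by rewrite mulrBl mul1r.
have [|r Jr Hr] := IH.
  move=> w wws; have [_ [x Jx ->] Zw] : span_over J Q (w0 :: ws) w.
    by apply: Hws; rewrite inE wws orbT.
  rewrite (_ : w = (1 - j0) * (w - x * w0) + x * ((1 - j0) * w0) + j0 * w).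
    apply: idealD => //; last exact: span_mem.
    by apply: idealD => //; exact: ideal_mull.
  by ring.
exists (r + j0 - r * j0).
  by apply: idealB => //; [exact: idealD | exact: ideal_mull].
rewrite (_ : 1 - _ = (1 - r) * (1 - j0)); last by ring.
move=> w; rewrite inE => /orP[/eqP ->|wws].
  by rewrite -mulrA; apply: span_mul Z0.
by rewrite mulrAC mulrC; apply: ideal_mull => //; exact: Hr.
Qed.

End Nakayama.

Section Powers.
Variables (R : realType) (A : comAlgType R[i]) (nm : A -> R).
Hypothesis hnm : banach_norm nm.
Variables (psi : A -> R[i]) (n : nat) (g : 'I_n -> A) (C : R).
Hypotheses (hpsi : is_character psi) (g0 : forall i, psi (g i) = 0)
  (C0 : 0 <= C)
  (gen : forall a, exists b : 'I_n -> A, a = (psi a)%:A + \sum_i b i * g i /\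
    forall i, nm (b i) <= C * nm a).

(* [ker_pow k] is the k-th power of the ideal ker psi. *)
Fixpoint ker_pow k : set A := if k is k'.+1 then
  [set a | exists2 b : 'I_n -> A, forall i, ker_pow k' (b i) & a = \sum_i b i * g i]
  else setT.

Lemma ker_pow_ideal k : is_ideal (ker_pow k).
Proof.
elim: k => [|k IH] //=; split.
- exists (fun=> 0); first by move=> i; exact: ideal0.
  by rewrite big1// => i _; rewrite mul0r.
- move=> _ _ [b Hb ->] [c Hc ->]; exists (fun i => b i + c i).
    by move=> i; exact: idealD.
  by rewrite -big_split/=; apply: eq_bigr => i _; rewrite mulrDl.
- move=> a _ [b Hb ->]; exists (fun i => a * b i).
    by move=> i; exact: ideal_mull.
  by rewrite mulr_sumr; apply: eq_bigr => i _; rewrite mulrA.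
Qed.

Lemma ker_powS k : ker_pow k.+1 `<=` ker_pow k.
Proof.
elim: k => [|k IH]//= _ [b Hb ->]; exists b => // i; apply: IH.
exact: Hb.
Qed.

Lemma ker_pow_le k l : (k <= l)%N -> ker_pow l `<=` ker_pow k.
Proof.
move=> /subnKC <-; elim: (l - k)%N => [|m IH]; first by rewrite addn0.
by rewrite addnS => a /ker_powS /IH.
Qed.

Lemma ker_powM k l a b : ker_pow k a -> ker_pow l b -> ker_pow (k + l) (a * b).
Proof.
move=> + lb; elim: k a => [|k IH] a /=.
  by move=> _; apply: ideal_mull => //; exact: ker_pow_ideal.
move=> [c Hc ->]; exists (fun i => c i * b).
  by move=> i; exact: IH.
by rewrite mulr_suml; apply: eq_bigr => i _; rewrite mulrAC.
Qed.

Lemma ker_pow1P a : ker_pow 1 a <-> psi a = 0.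
Proof.
split.
  move=> /= [b _ ->]; rewrite char_sum// big1// => i _.
  by rewrite charM// g0 mulr0.
move=> a0; have [b [E _]] := gen a; exists b => //.
by rewrite {1}E a0 scale0r add0r.
Qed.

Lemma ker_powX a k : psi a = 0 -> ker_pow k (a ^+ k).
Proof.
move=> /ker_pow1P a1; elim: k => [|k IH] //.
by rewrite exprS -addn1 addnC; exact: ker_powM.
Qed.

Lemma ker_pow_stable (I : set A) k : is_ideal I -> ker_pow k `<=` idsum I (ker_pow k.+1) ->
  forall l, ker_pow k `<=` idsum I (ker_pow (k + l)).
Proof.
move=> hI H; have hS m : is_ideal (idsum I (ker_pow m)).
  by apply: idsum_ideal => //; exact: ker_pow_ideal.
have HH l : ker_pow (k + l) `<=` idsum I (ker_pow (k + l).+1).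
  elim: l => [|l IH]; first by rewrite addn0.
  rewrite addnS => _ [b Hb ->]; apply: ideal_sum => // i _.
  have [x Ix bx] := IH _ (Hb i); exists (x * g i); first exact: ideal_mulr.
  rewrite -mulrBl; rewrite -[X in ker_pow X]addn1; apply: ker_powM => //.
  by apply/ker_pow1P; exact: g0.
elim=> [|l IH] a ka; first by rewrite addn0; apply: idsumr.
have [x Ix ax] := IH _ ka; rewrite -(subrK x a) addnS; apply: idealD => //.
  exact: HH.
by apply: idsuml => //; exact: ker_pow_ideal.
Qed.

Lemma ker_pow_gens k : exists (I J : finType) (x : I -> A) (w : J -> A) (D : R),
  [/\ 0 <= D, forall j, ker_pow k (w j),
    forall l a, ker_pow (k + l) a ->
      exists2 b : J -> A, forall j, ker_pow l (b j) & a = \sum_j b j * w j &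
    forall a, exists (c : I -> R[i]) (b : J -> A),
      [/\ a = \sum_i c i *: x i + \sum_j b j * w j,
        forall i, cabs (c i) <= D * nm a & forall j, nm (b j) <= D * nm a]].
Proof.
elim: k => [|k [I [J [x [w [D [D0 Hw Hl HD]]]]]]].
  exists void, unit, (fun=> 0), (fun=> 1), 1; split => //.
    move=> l a la; exists (fun=> a) => //.
    by rewrite big_const card_unit /= addr0 mulr1.
  move=> a; exists (fun=> 0), (fun=> a); split => //.
  - rewrite [X in X + _]big1; last by move=> [].
    by rewrite big_const card_unit /= addr0 mulr1 add0r.
  - by move=> _; rewrite mul1r.
exists (unit + ('I_n * I))%type, ('I_n * J)%type.
exists (fun z => if z is inr p then x p.2 * g p.1 else 1).
(* The 2 bounds the new coefficient psi(a), by [char_bound]; D C bounds those coming from the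
   expansions of the b_i. *)
exists (fun p => w p.2 * g p.1), (2 + D * C); split.
- by rewrite addr_ge0// mulr_ge0.
- by move=> [i j]; have := @ker_powM k 1 _ _ (Hw j) ((ker_pow1P (g i)).2 (g0 i)); rewrite addn1.
- move=> l a; rewrite addSn => -[b Hb ->].
  have /choice[m Hm] : forall i, exists m : J -> A,
    (forall j, ker_pow l (m j)) /\ b i = \sum_j m j * w j.
    by move=> i; have [m ? ?] := Hl _ _ (Hb i); exists m.
  exists (fun p => m p.1 p.2) => [[i j]|] /=; first by have [] := Hm i.
  rewrite (eq_bigr (fun p => (m p.1 p.2 * w p.2) * g p.1)); last first.
    by move=> p _; rewrite mulrA.
  rewrite -(pair_bigA _ (fun i j => m i j * w j * g i))/=.
  by apply: eq_bigr => i _; rewrite -mulr_suml; have [_ <-] := Hm i.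
- move=> a; have [b [Ea Hb]] := gen a.
  have /choice[c Hc] : forall i, exists c : (I -> R[i]) * (J -> A),
    [/\ b i = \sum_j c.1 j *: x j + \sum_j c.2 j * w j,
      forall j, cabs (c.1 j) <= D * nm (b i) & forall j, nm (c.2 j) <= D * nm (b i)].
    by move=> i; have [c1 [c2 ?]] := HD (b i); exists (c1, c2).
  have bound i y : y <= D * nm (b i) -> y <= (2 + D * C) * nm a.
    move=> /le_trans; apply; rewrite mulrDl -mulrA.
    rewrite ler_wpDl ?mulr_ge0 ?(nm_ge0 hnm)// ler_wpM2l//.
  exists (fun z => if z is inr p then (c p.1).1 p.2 else psi a).
  exists (fun p => (c p.1).2 p.2); split.
  + rewrite big_sumType/= big_const card_unit /= addr0.
    rewrite -addrA {1}Ea; congr (_ + _).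
    rewrite (eq_bigr (fun p => ((c p.1).1 p.2 *: x p.2) * g p.1)); last first.
      by move=> p _; rewrite scalerAl.
    rewrite -(pair_bigA _ (fun i j => ((c i).1 j *: x j) * g i))/=.
    rewrite [X in _ = _ + X](eq_bigr (fun p => ((c p.1).2 p.2 * w p.2) * g p.1)); last first.
      by move=> p _; rewrite mulrA.
    rewrite -(pair_bigA _ (fun i j => ((c i).2 j * w j) * g i))/=.
    rewrite -big_split/=; apply: eq_bigr => i _.
    by rewrite -!mulr_suml -mulrDl; have [<-] := Hc i.
  + move=> [_|[i j]] /=; last by apply: (bound i); have [] := Hc i.
    rewrite (le_trans (char_bound hnm a hpsi))// ler_wpM2r ?(nm_ge0 hnm)//.
    by rewrite lerDl mulr_ge0.
  + by move=> [i j] /=; apply: (bound i); have [] := Hc i.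
Qed.

(** Stabilisation gives M^K = M^K M^K, so Nakayama yields r in M^K with (1 - r) M^K = 0. Then e = 1
    - r is idempotent, and eA is spanned by the e x_i, because e kills the part of A in M^K. *)
Lemma ker_pow_idempotent k : ker_pow k `<=` ker_pow k.+1 ->
  exists e, [/\ e * e = e, psi e = 1 &
    exists (I : finType) (x : I -> A), forall a, exists c : I -> R[i],
      e * a = \sum_i c i *: x i].
Proof.
(* With k + 1 in place of k, the elements of M^K vanish at psi even when k = 0. *)
move=> kS; pose K := k.+1; have hK := ker_pow_ideal K.
have KK : ker_pow K `<=` ker_pow (K + K).
  move=> a Ka; have [|x -> ax] := @ker_pow_stable [set 0] K (@set0_ideal A) _ K a Ka.
    move=> b [c Hc ->]; apply: idsumr; first exact: set0_ideal.
    by exists c => // i; apply: kS; exact: Hc.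
  by rewrite subr0 in ax.
have [I [J [x [w [D [_ Hw Hl HD]]]]]] := ker_pow_gens K.
have [|r Kr Hr] := @nakayama A (ker_pow K) [set 0] [seq w j | j <- index_enum J] hK (@set0_ideal A).
  move=> _ /mapP[j _ ->]; have [m Hm Em] := Hl _ _ (KK _ (Hw j)).
  by apply: (span_sum (m := m)) => //=; rewrite {1}Em subrr.
have {}Hr a : ker_pow K a -> (1 - r) * a = 0.
  rewrite -[K]addn0 => /Hl[b _ ->]; rewrite mulr_sumr big1// => j _.
  by rewrite mulrCA (Hr (w j)) ?mulr0// map_f// mem_index_enum.
have psir : psi r = 0 by apply/ker_pow1P; exact: (ker_pow_le (ltn0Sn k)).
exists (1 - r); split.
- by rewrite mulrBr mulr1 Hr// subr0.
- by rewrite charB// char1// psir subr0.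
exists I, (fun i => (1 - r) * x i) => a; have [c [b [E _ _]]] := HD a.
exists c; rewrite E mulrDr [X in _ + X]Hr; last first.
  by apply: ideal_sum => // j _; apply: ideal_mull => //.
by rewrite addr0 mulr_sumr; apply: eq_bigr => i _; rewrite scalerAr.
Qed.

(* The local ring of A/I at psi is not Artinian. *)
Definition unstable (I : set A) := forall k, ~ (ker_pow k `<=` idsum I (ker_pow k.+1)).

(** M^k is finitely generated, so stabilisation modulo the union involves finitely many of its
    elements, all in one member X of the chain. *)
Lemma unstable_chain (F : set (set A)) : F !=set0 -> total_on F subset ->
  (forall X, F X -> is_ideal X /\ unstable X) -> unstable (\bigcup_(X in F) X).
Proof.
move=> [X0 FX0] totF HF k Hk.
have [I [J [x [w [D [_ Hw Hl HD]]]]]] := ker_pow_gens k.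
have /choice[u Hu] : forall j, exists y, (\bigcup_(X in F) X) y /\ ker_pow k.+1 (w j - y).
  by move=> j; have [y ? ?] := Hk _ (Hw j); exists y.
have [X FX HX] : exists2 X, F X & forall j, j \in index_enum J -> X (u j).
  elim: (index_enum J) => [|j r [X FX HX]]; first by exists X0.
  have [[Y FY Yj] _] := Hu j; have [XY|YX] := totF _ _ FX FY.
    by exists Y => // i; rewrite inE => /orP[/eqP ->//|/HX /XY].
  by exists X => // i; rewrite inE => /orP[/eqP ->|/HX//]; exact: YX.
have [hX unstableX] := HF _ FX; apply: (unstableX k) => a; rewrite -[k]addn0 => /Hl[b _ ->].
have hX' : is_ideal (idsum X (ker_pow (k + 0).+1)).
  by apply: idsum_ideal => //; exact: ker_pow_ideal.
apply: ideal_sum => // j _; apply: ideal_mull => //; rewrite addn0.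
by exists (u j); [apply: HX; exact: mem_index_enum | have [] := Hu j].
Qed.

Section UnstablePrime.
Variable J0 : set A.
Hypotheses (hJ0 : is_ideal J0) (unstableJ0 : unstable J0).

Lemma unstable_maximal : exists P, [/\ is_ideal P, unstable P, J0 `<=` P &
  forall a, ~ P a -> exists k, forall l, ker_pow k `<=` idsum (idsum (principal a) P) (ker_pow l)].
Proof.
have [|P [hP bP JP maxP]] := @ideal_zorn A unstable J0 hJ0 unstableJ0.
  by move=> F F0 totF HF; apply: unstable_chain => // X /HF[].
exists P; split => // a Pa.
have hQ : is_ideal (idsum (principal a) P).
  by apply: idsum_ideal => //; exact: principal_ideal.
have : ~ unstable (idsum (principal a) P).
  move=> bQ; apply: Pa; apply: (maxP _ hQ _ bQ).
    by move=> b Pb; apply: idsumr => //; exact: principal_ideal.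
  by apply: idsuml => //; exact: principal_id.
move=> /existsNP[k /contrapT Hk]; exists k => l.
have [kl|lk] := leqP k l; first by rewrite -(subnKC kl); exact: ker_pow_stable.
move=> b kb; apply: idsumr => //; apply: ker_pow_le kb; exact: ltnW.
Qed.

(** If ab is in P but neither factor is, multiplying M^k in aA + P + M^n by M^l in bA + P + M^n
    gives M^(k+l) in P + M^n; n = k + l + 1 contradicts instability. Some generator lies outside P,
    as otherwise M would lie in P and its powers would stabilise at once modulo P; it serves as
    h. *)
Lemma unstable_prime : exists P, [/\ is_ideal P, J0 `<=` P, forall a, P a -> psi a = 0,
  forall a b, P (a * b) -> ~ P a -> P b &
  exists h u K, [/\ psi h = 0, ~ P h, psi u = 1 &
     forall a, ker_pow K a -> idsum (principal h) P (u * a)]].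
Proof.
have [P [hP bP JP good]] := unstable_maximal.
exists P.
have Ppsi a : P a -> psi a = 0.
  move=> Pa; have [//|a0] := eqVneq (psi a) 0; exfalso; apply: (bP 0%N) => b _.
  exists (((psi a)^-1 *: b) * a); first exact: ideal_mull.
  apply/ker_pow1P; rewrite charB// charM// charZ// mulrAC mulVf// mul1r subrr//.
have prP a b : P (a * b) -> ~ P a -> P b.
  move=> Pab Pa; apply: contrapT => Pb.
  have [k Hk] := good _ Pa; have [l Hl] := good _ Pb.
  apply: (bP (k + l)%N) => c.
  have [I [J [x [w [D [_ Hw Hwl HD]]]]]] := ker_pow_gens k.
  move=> /Hwl[m Hm ->]; apply: ideal_sum.
    by apply: idsum_ideal => //; exact: ker_pow_ideal.
  move=> j _; have := Hk (k + l).+1 _ (Hw j).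
  have : idsum (idsum (principal b) P) (ker_pow (k + l).+1) (m j).
    by apply: Hl; exact: Hm.
  move=> [s [_ [y _ ->] sy] ms] [t [_ [z _ ->] tz] wt].
  exists (s * t).
    rewrite (_ : s * t = (y * z) * (a * b) + (y * b * (t - z * a) + t * (s - y * b))).
      by apply: idealD => //; [|apply: idealD => //]; exact: ideal_mull.
    by ring.
  rewrite (_ : _ - _ = (m j - s) * w j + s * (w j - t)); last by ring.
  have hp := ker_pow_ideal (k + l).+1.
  by apply: idealD => //; [exact: ideal_mulr | exact: ideal_mull].
split => //.
have [i Pgi] : exists i, ~ P (g i).
  apply: contrapT => /forallNP H; apply: (bP 1%N) => _ [b _ ->].
  apply: idsuml; first exact: ker_pow_ideal.
  by apply: ideal_sum => // i _; apply: ideal_mull => //; apply: contrapT; exact: H.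
have [K HK] := good _ Pgi; exists (g i).
have hQ : is_ideal (idsum (principal (g i)) P).
  by apply: idsum_ideal => //; exact: principal_ideal.
have [I [J [x [w [D [_ Hw Hl HD]]]]]] := ker_pow_gens K.
(* M^K is contained in hA + P + M M^K, so there is r in M with (1 - r) M^K in hA + P; then u = 1 - r
   has value 1 at psi. *)
have [|r Kr Hr] := @nakayama A (ker_pow 1) (idsum (principal (g i)) P)
   [seq w j | j <- index_enum J] (ker_pow_ideal 1) hQ.
  move=> _ /mapP[j _ ->]; have [y Qy] := HK (K + 1)%N _ (Hw j).
  move=> /Hl[m Hm E]; apply: (span_sum (m := m)) => //.
  by rewrite -E opprB addrC subrK.
exists (1 - r), K; split => //.
  by rewrite charB// char1// ((ker_pow1P r).1 Kr) subr0.
move=> a; rewrite -[K]addn0 => /Hl[b _ ->]; rewrite mulr_sumr.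
apply: ideal_sum => // j _; rewrite mulrCA; apply: ideal_mull => //.
by apply: Hr; rewrite map_f// mem_index_enum.
Qed.

End UnstablePrime.
End Powers.

(** * Division with remainder and evaluation *)

Section Division.
Variables (R : realType) (A : comAlgType R[i]) (nm : A -> R).
Hypothesis hnm : banach_norm nm.
Variables (psi : A -> R[i]) (P : set A) (h : A).
Hypotheses (hpsi : is_character psi) (hP : is_ideal P)
  (Ppsi : forall a, P a -> psi a = 0)
  (prP : forall a b, P (a * b) -> ~ P a -> P b)
  (h0 : psi h = 0) (Ph : ~ P h).

(* Division by h modulo P with remainder in the span of e, in the localisation at
   psi: v is the denominator. *)
Definition division_family r (e : 'I_r -> A) v (C : R) :=
  [/\ psi v != 0, 0 <= C & forall a, exists (b : 'I_r -> R[i]) (d : A),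
    [/\ P (v * (a - \sum_j b j *: e j) - h * d),
      forall j, cabs (b j) <= C * nm a & nm d <= C * nm a]].

(** Linear independence of the e_j modulo h in the localisation of A/P at psi; s is a
    denominator. *)
Definition division_free r (e : 'I_r -> A) := forall s (b : 'I_r -> R[i]) d,
  psi s != 0 -> P (s * (\sum_j b j *: e j) - h * d) -> forall j, b j = 0.

Lemma division_family_elim r (e : 'I_r.+1 -> A) v C : division_family e v C -> ~ division_free e ->
  exists (e' : 'I_r -> A) v' C', division_family e' v' C'.
Proof.
move=> [v0 C0 He] /existsNP[s] /existsNP[b] /existsNP[d].
move=> /not_implyP[s0] /not_implyP[Psd] /existsNP[j0 /eqP b0].
pose k := cabs (b j0)^-1; have k0 : 0 <= k by exact: cabs_ge0.
pose S := \sum_i cabs (b (lift j0 i)).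
have S0 : 0 <= S by apply: sumr_ge0 => i _; exact: cabs_ge0.
pose T := nm s + nm v * (k * nm d).
have T0 : 0 <= T by rewrite addr_ge0 ?mulr_ge0 ?(nm_ge0 hnm).
have kS0 : 0 <= k * S by exact: mulr_ge0.
exists (fun i => e (lift j0 i)), (v * s), (C * (1 + k * S + T)); split.
- by rewrite charM// mulf_neq0.
- by apply: mulr_ge0 => //; lra.
move=> a; have [c [da [Pa Hc Hda]]] := He a; pose l := c j0 / b j0.
exists (fun i => c (lift j0 i) - l * b (lift j0 i)), (s * da + v * (l *: d)); split.
- have -> : v * s * (a - \sum_j (c (lift j0 j) - l * b (lift j0 j)) *: e (lift j0 j)) -
       h * (s * da + v * (l *: d)) =
     s * (v * (a - \sum_j c j *: e j) - h * da) +
     (v * l%:A) * (s * (\sum_j b j *: e j) - h * d).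
    rewrite !(bigD1_ord j0)//=.
    under eq_bigr do rewrite scalerBl -scalerA.
    rewrite sumrB -scaler_sumr.
    rewrite (_ : c j0 *: e j0 = l *: (b j0 *: e j0)); last by rewrite scalerA divfK.
    move: (b j0 *: e j0) (\sum_i c _ *: _) (\sum_i b _ *: _) => x y z.
    rewrite -[l *: z]mulr_algl -[l *: x]mulr_algl -[l *: d]mulr_algl.
    by move: (l%:A) => l'; ring.
  by apply: idealD => //; exact: ideal_mull.
- move=> i; apply: le_trans (cabsD _ _) _; rewrite cabsN !cabsM -/k.
  apply: le_trans (_ : C * nm a + C * nm a * k * S <= _).
    rewrite lerD// ler_pM ?cabs_ge0 ?mulr_ge0 ?cabs_ge0//.
      by rewrite ler_wpM2r.
    by rewrite /S (bigD1 i)//= lerDl sumr_ge0// => *; exact: cabs_ge0.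
  have a0 := nm_ge0 hnm a; have : 0 <= C * nm a * T by rewrite !mulr_ge0.
  by rewrite !mulrDr !mulrDl; nra.
- apply: le_trans (nmD hnm _ _) _.
  apply: le_trans (_ : nm s * (C * nm a) + nm v * (C * nm a * k * nm d) <= _).
    rewrite lerD// (le_trans (nmM hnm _ _))// ler_wpM2l ?(nm_ge0 hnm)//.
    by rewrite (nmZ hnm) cabsM -/k ler_wpM2r ?(nm_ge0 hnm)// ler_wpM2r.
  have a0 := nm_ge0 hnm a; have : 0 <= C * nm a * (1 + k * S).
    by apply: mulr_ge0; [exact: mulr_ge0 | lra].
  by rewrite /T; nra.
Qed.

Lemma division_family_min r0 (e0 : 'I_r0 -> A) v0 C0 : division_family e0 v0 C0 ->
  exists r (e : 'I_r.+1 -> A) v C, division_family e v C /\ division_free e.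
Proof.
move=> H0.
have : exists r, `[< exists (e : 'I_r -> A) v C, division_family e v C >].
  by exists r0; apply/asboolP; exists e0, v0, C0.
move=> /ex_minnP[r /asboolP[e [v [C He]]] minr].
(* An empty family would put v - hd in P for some d, whence psi(v) = 0. *)
case: r => [|r] in e He minr *.
  have [vn _ /(_ 1)[b [d [Pd _ _]]]] := He.
  have := Ppsi Pd; rewrite big_ord0 subr0 mulr1 charB// charM// h0 mul0r subr0.
  by move/eqP; rewrite (negPf vn).
exists r, e, v, C; split => //; apply: contrapT => /(division_family_elim He) H.
by have := minr r (asboolT H); rewrite ltnn.
Qed.

(** * Expansion in powers of t = h / v *)

Section Expansion.
Variables (r : nat) (e : 'I_r -> A) (v : A) (C : R).
Variables (b : A -> 'I_r -> R[i]) (D : A -> A).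
Hypotheses (v0 : psi v != 0) (C0 : 0 <= C) (ind : division_free e)
  (bP : forall a, P (v * (a - \sum_j b a j *: e j) - h * D a))
  (bC : forall a j, cabs (b a j) <= C * nm a)
  (DC : forall a, nm (D a) <= C * nm a).

Lemma coef_uniq s a c d : psi s != 0 ->
  P (s * (a - \sum_j c j *: e j) - h * d) -> b a = c.
Proof.
move=> s0 Pc; apply/funext => j; apply/eqP; rewrite -subr_eq0; apply/eqP.
apply: (ind (s := v * s) (b := fun j => b a j - c j) (d := v * d - s * D a)).
  by rewrite charM// mulf_neq0.
under eq_bigr do rewrite scalerBl.
rewrite sumrB; have := bP a; move: Pc.
move: (\sum_j c j *: e j) (\sum_j b a j *: e j) => x y Px Py.
rewrite (_ : _ - h * _ = v * (s * (a - x) - h * d) - s * (v * (a - y) - h * D a)).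
  by apply: idealB => //; exact: ideal_mull.
by ring.
Qed.

(** P is prime and h is not in P, so h can be cancelled from the difference of two divisions. As D
    is a mere choice, its linearity will hold only modulo P. *)
Lemma quot_uniq a c d : P (v * (a - \sum_j c j *: e j) - h * d) ->
  b a = c /\ P (d - D a).
Proof.
move=> Pc; have E := coef_uniq v0 Pc; split => //.
have := bP a; rewrite E => Pb; apply: (prP (a := h)) => //.
rewrite (_ : h * _ = (v * (a - \sum_j c j *: e j) - h * D a) -
   (v * (a - \sum_j c j *: e j) - h * d)); first exact: idealB.
by move: (\sum_j _) => x; ring.
Qed.

Lemma coef_lin k x y : b (k *: x + y) = (fun j => k * b x j + b y j) /\
  P (k *: D x + D y - D (k *: x + y)).
Proof.
apply: quot_uniq; under eq_bigr do rewrite scalerDl -scalerA.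
rewrite big_split/= -scaler_sumr; have := bP x; have := bP y.
move: (\sum_j b y j *: e j) (\sum_j b x j *: e j) => s t Ps Pt.
rewrite (_ : _ - h * _ = k%:A * (v * (x - t) - h * D x) + (v * (y - s) - h * D y)).
  by apply: idealD => //; exact: ideal_mull.
rewrite -[k *: x]mulr_algl -[k *: t]mulr_algl -[k *: D x]mulr_algl.
by move: (k%:A) => l; ring.
Qed.

Lemma coefP a : P a -> b a = (fun=> 0) /\ P (D a).
Proof.
move=> Pa; have [|-> PD] := @quot_uniq a (fun=> 0) 0.
  rewrite big1 ?mulr0 ?subr0; first exact: ideal_mull.
  by move=> j _; rewrite scale0r.
by split => //; rewrite -[D a]opprK; apply: idealN => //; rewrite -sub0r.
Qed.

Lemma quot_congr x y : P (x - y) -> b x = b y /\ P (D x - D y).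
Proof.
move=> Pxy; have [Eb PD] := coef_lin 1 (x - y) y.
have [b0 PDxy] := coefP Pxy; move: Eb PD; rewrite scale1r subrK b0 => ->.
split; first by apply/funext => j; rewrite mulr0 add0r.
rewrite (_ : D x - D y = D (x - y) - (1 *: D (x - y) + D y - D x)).
  exact: idealB.
by rewrite scale1r; ring.
Qed.

Lemma coef_basis i : b (e i) = (fun j => (j == i)%:R) /\ P (D (e i)).
Proof.
have [|-> PD] := @quot_uniq (e i) (fun j => (j == i)%:R) 0.
  rewrite (bigD1 i)//= eqxx scale1r big1.
    by rewrite addr0 subrr !mulr0 subr0; exact: ideal0.
  by move=> j /negPf ->; rewrite scale0r.
by split => //; rewrite -[D _]opprK; apply: idealN => //; rewrite -sub0r.
Qed.

Lemma iter_lin k l x y :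
  P (l *: iter k D x + iter k D y - iter k D (l *: x + y)).
Proof.
elim: k => [|k IH] /=; first by rewrite subrr; exact: ideal0.
have [_ PD] := quot_congr IH; have [_ PD'] := coef_lin l (iter k D x) (iter k D y).
rewrite -[X in X - _](subrK (D (l *: iter k D x + iter k D y))) -addrA.
exact: idealD.
Qed.

(* The coefficient of t^k in the expansion of a in powers of t = h / v. *)
Definition tcoef k a := b (iter k D a).

Lemma tcoef_lin k l x y j :
  tcoef k (l *: x + y) j = l * tcoef k x j + tcoef k y j.
Proof.
have [E _] := quot_congr (iter_lin k l x y); rewrite /tcoef -E.
by have [->] := coef_lin l (iter k D x) (iter k D y).
Qed.

Lemma iter_bound k a : nm (iter k D a) <= C ^+ k * nm a.
Proof.
elim: k => [|k IH]; first by rewrite mul1r.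
by rewrite iterS (le_trans (DC _))// exprS -mulrA ler_wpM2l.
Qed.

Lemma coefB x y j : b (x - y) j = b x j - b y j.
Proof.
have [+ _] := coef_lin (-1) y x; rewrite scaleN1r addrC => ->.
by rewrite mulN1r addrC.
Qed.

Lemma coef_psum t a j k : b (\sum_(i < k) t ^+ i *: iter i D a) j =
  \sum_(i < k) t ^+ i * tcoef i a j.
Proof.
elim: k => [|k IH].
  by rewrite !big_ord0; have [->] := coefP (ideal0 hP).
rewrite !big_ord_recr/= addrC; have [-> _] := coef_lin (t ^+ k) (iter k D a)
  (\sum_(i < k) t ^+ i *: iter i D a).
by rewrite IH addrC.
Qed.

(* The series is summed in A before taking coefficients, so that only the
   completeness of A is needed. *)
Lemma expansion_exists t : cabs t * C <= 2^-1 -> exists L : A -> 'I_r -> R[i],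
  forall a j k, cabs (L a j - \sum_(i < k) t ^+ i * tcoef i a j) <=
    2 * C * nm a * 2^-1 ^+ k.
Proof.
move=> tC; suff /choice[L HL] : forall a, exists L : 'I_r -> R[i],
  forall j k, cabs (L j - \sum_(i < k) t ^+ i * tcoef i a j) <=
    2 * C * nm a * 2^-1 ^+ k by exists L.
move=> a; pose u k := \sum_(i < k) t ^+ i *: iter i D a.
have [k|l Hl] := nm_complete hnm (u := u) (B := nm a).
  rewrite /u big_ord_recr/= addrAC subrr add0r (nmZ hnm) cabsX.
  apply: le_trans (_ : cabs t ^+ k * (C ^+ k * nm a) <= _).
    by rewrite ler_wpM2l ?exprn_ge0 ?cabs_ge0// iter_bound.
  rewrite mulrA -exprMn mulrC ler_wpM2l ?(nm_ge0 hnm)//.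
  by rewrite lerXn2r// nnegrE// mulr_ge0 ?cabs_ge0.
exists (b l) => j k; rewrite -coef_psum -coefB (le_trans (bC _ _))//.
by rewrite (mulrC 2) -!mulrA ler_wpM2l// mulrA Hl.
Qed.

(** * Evaluation of the expansions at a small t *)

Section Evaluation.
Variables (t : R[i]) (L : A -> 'I_r -> R[i]).
Hypothesis HL : forall a j k,
  cabs (L a j - \sum_(i < k) t ^+ i * tcoef i a j) <= 2 * C * nm a * 2^-1 ^+ k.
Hypothesis tC : cabs t * C <= 2^-1.

Lemma cabs_half_eq0 (z : R[i]) B : (forall k, cabs z <= B * 2^-1 ^+ k) -> z = 0.
Proof.
move=> H; apply/eqP; rewrite -cabs_eq0; apply/eqP/le_anti.
by rewrite cabs_ge0 andbT; exact: half_pow_le0 H.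
Qed.

Lemma eval_lin k x y j : L (k *: x + y) j = k * L x j + L y j.
Proof.
apply/eqP; rewrite -subr_eq0; apply/eqP.
pose B a := 2 * C * nm a.
apply: (@cabs_half_eq0 _ (B (k *: x + y) + (cabs k * B x + B y))) => m.
set s := fun a => \sum_(i < m) t ^+ i * tcoef i a j.
have E : s (k *: x + y) = k * s x + s y.
  rewrite /s mulr_sumr -big_split/=; apply: eq_bigr => i _.
  by rewrite tcoef_lin mulrDr mulrCA.
rewrite (_ : _ - _ = (L (k *: x + y) j - s (k *: x + y)) -
   (k * (L x j - s x) + (L y j - s y))); last by rewrite E; ring.
rewrite (le_trans (cabsD _ _))// cabsN !mulrDl lerD ?HL//.
rewrite (le_trans (cabsD _ _))// lerD ?HL// cabsM -mulrA ler_wpM2l ?cabs_ge0//.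
exact: HL.
Qed.

Lemma evalD x y j : L (x + y) j = L x j + L y j.
Proof. by rewrite -[x]scale1r eval_lin mul1r scale1r. Qed.

Lemma eval0 j : L 0 j = 0.
Proof. by apply: (@addIr _ (L 0 j)); rewrite -evalD !add0r. Qed.

Lemma evalZ k x j : L (k *: x) j = k * L x j.
Proof. by rewrite -[_ *: _]addr0 eval_lin eval0 addr0. Qed.

Lemma evalB x y j : L (x - y) j = L x j - L y j.
Proof. by rewrite evalD -scaleN1r evalZ mulN1r. Qed.

Lemma eval_sum (T : Type) (s : seq T) (F : T -> A) j :
  L (\sum_(i <- s) F i) j = \sum_(i <- s) L (F i) j.
Proof. by apply: (big_morph (fun a => L a j)) => [x y|]; rewrite ?evalD ?eval0. Qed.

Lemma eval_bound a j : cabs (L a j) <= 2 * C * nm a.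
Proof. by have := HL a j 0; rewrite big_ord0 subr0 mulr1. Qed.

(** The coefficients of D a are those of a shifted by one place. Iterating this equation is the main
    tool for the properties of L. *)
Lemma eval_rec a j : L a j = b a j + t * L (D a) j.
Proof.
apply/eqP; rewrite -subr_eq0; apply/eqP.
pose B a := 2 * C * nm a.
apply: (@cabs_half_eq0 _ (B a * 2^-1 + cabs t * B (D a))) => m.
have H1 := HL a j m.+1; have H2 := HL (D a) j m.
rewrite (_ : _ - _ = (L a j - \sum_(i < m.+1) t ^+ i * tcoef i a j) -
   t * (L (D a) j - \sum_(i < m) t ^+ i * tcoef i (D a) j)).
  rewrite (le_trans (cabsD _ _))// cabsN cabsM mulrDl lerD//.
    by rewrite -mulrA -exprS.
  by rewrite -mulrA ler_wpM2l ?cabs_ge0.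
rewrite big_ord_recl/= expr0 mul1r mulrBr mulr_sumr.
rewrite (eq_bigr (fun i : 'I_m => t * (t ^+ i * tcoef i (D a) j))).
  by rewrite /tcoef/=; ring.
by move=> i _; rewrite /tcoef /bump leq0n add1n exprS mulrA iterSr.
Qed.

Lemma eval_ideal a j : P a -> L a j = 0.
Proof.
move=> Pa; apply: (@cabs_half_eq0 _ (2 * C * nm a)) => k.
have := HL a j k; rewrite big1 ?subr0// => i _.
suff Pi m : P (iter m D a) by have [E _] := coefP (Pi i); rewrite /tcoef E mulr0.
by elim: m => //= m IH; have [] := coefP IH.
Qed.

Lemma eval_congr x y j : P (x - y) -> L x j = L y j.
Proof.
by move=> /(eval_ideal j) /eqP; rewrite evalB subr_eq0 => /eqP.
Qed.

Lemma eval_basis i j : L (e i) j = (j == i)%:R.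
Proof.
by have [E PD] := coef_basis i; rewrite eval_rec E (eval_ideal j PD) mulr0 addr0.
Qed.

(** Division of c by h leaves remainder 0 and quotient d. Applied to c = hx and d = vx, this says
    that h acts as tv. *)
Lemma eval_shift c d j : P (v * c - h * d) -> L c j = t * L d j.
Proof.
move=> Pcd; have [|E PD] := @quot_uniq c (fun=> 0) d.
  by rewrite big1 ?subr0// => i _; rewrite scale0r.
by rewrite eval_rec E add0r (eval_congr j PD).
Qed.

(** The remainder is exactly t^k L(D^k a). The ratio |t| C, in place of the uniform 1/2, makes the
    tail small with t, as the maximum principle requires. *)
Lemma eval_tail a j k : cabs (L a j - \sum_(i < k) t ^+ i * tcoef i a j) <=
  2 * C * nm a * (cabs t * C) ^+ k.
Proof.
have E m : L a j - \sum_(i < m) t ^+ i * tcoef i a j = t ^+ m * L (iter m D a) j.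
  elim: m => [|m IH]; first by rewrite big_ord0 subr0 mul1r.
  rewrite big_ord_recr/= opprD addrA IH eval_rec /tcoef exprS; ring.
rewrite E cabsM cabsX exprMn.
rewrite (_ : 2 * C * nm a * _ = cabs t ^+ k * (2 * C * (C ^+ k * nm a))); last by ring.
rewrite ler_wpM2l ?exprn_ge0 ?cabs_ge0// (le_trans (eval_bound _ _))//.
by rewrite ler_wpM2l ?mulr_ge0// iter_bound.
Qed.

(** The defect d of the formula satisfies d(y) = t d(D y) and |d(y)| <= B nm(y), so |d(y)| <= B
    nm(y) (|t| C)^k for all k. Multiplication by f thus acts on remainders through a matrix. *)
Lemma eval_mul f x j : L (f * x) j = \sum_i L x i * L (f * e i) j.
Proof.
pose d y := L (f * y) j - \sum_i L y i * L (f * e i) j.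
suff H y : d y = 0 by apply/eqP; rewrite -subr_eq0; apply/eqP; exact: H.
have drec z : d z = t * d (D z).
  have := @eval_shift (f * (z - \sum_j b z j *: e j)) (f * D z) j.
  rewrite mulrCA [h * _]mulrCA -mulrBr => /(_ (ideal_mull _ hP (bP z))).
  rewrite mulrBr evalB mulr_sumr eval_sum => /eqP; rewrite subr_eq => /eqP E.
  rewrite /d E mulrBr -addrA; congr (_ + _).
  rewrite mulr_sumr -sumrB -sumrN; apply: eq_bigr => i _.
  by rewrite -scalerAr evalZ (eval_rec z); ring.
pose B := 2 * C * nm f + \sum_i 2 * C * cabs (L (f * e i) j).
have dB z : cabs (d z) <= B * nm z.
  rewrite (le_trans (cabsD _ _))// cabsN mulrDl lerD//.
    rewrite (le_trans (eval_bound _ _))// -[leRHS]mulrA ler_wpM2l ?mulr_ge0//.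
    exact: nmM.
  rewrite (le_trans (cabs_sum _ _ _))// mulr_suml ler_sum// => i _.
  by rewrite cabsM mulrAC ler_wpM2r ?cabs_ge0// eval_bound.
apply: (@cabs_half_eq0 _ (B * nm y)) => k.
have -> : d y = t ^+ k * d (iter k D y).
  by elim: k => [|k ->]; rewrite ?mul1r//= drec mulrA exprSr.
rewrite cabsM cabsX; apply: le_trans (_ : cabs t ^+ k * (B * (C ^+ k * nm y)) <= _).
  rewrite ler_wpM2l ?exprn_ge0 ?cabs_ge0// (le_trans (dB _))// ler_wpM2l ?iter_bound//.
  rewrite addr_ge0 ?mulr_ge0 ?(nm_ge0 hnm)// sumr_ge0// => i _.
  by rewrite !mulr_ge0// cabs_ge0.
rewrite (_ : _ * _ = B * nm y * (cabs t * C) ^+ k); last by rewrite exprMn; ring.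
apply: ler_wpM2l; last by rewrite lerXn2r// nnegrE// mulr_ge0 ?cabs_ge0.
rewrite mulr_ge0 ?(nm_ge0 hnm)// addr_ge0 ?mulr_ge0 ?(nm_ge0 hnm)// sumr_ge0// => i _.
by rewrite !mulr_ge0// cabs_ge0.
Qed.

End Evaluation.

Lemma evaluation_exists t : cabs t * C <= 2^-1 -> exists L : A -> 'I_r -> R[i],
  [/\ forall k x y j, L (k *: x + y) j = k * L x j + L y j,
    forall a j, P a -> L a j = 0,
    forall i j, L (e i) j = (j == i)%:R,
    forall c d j, P (v * c - h * d) -> L c j = t * L d j &
    (forall f x j, L (f * x) j = \sum_i L x i * L (f * e i) j) /\
    forall a j k, cabs (L a j - \sum_(i < k) t ^+ i * tcoef i a j) <=
      2 * C * nm a * (cabs t * C) ^+ k].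
Proof.
move=> tC; have [L HL] := expansion_exists tC; exists L.
by split; [exact: eval_lin HL | exact: eval_ideal HL | exact: eval_basis HL |
  exact: eval_shift HL | split; [exact: eval_mul HL tC | exact: eval_tail HL]].
Qed.

End Expansion.
End Division.

(** * The analytic families of characters *)

(** Let tau_(m+1) be the first non-zero coefficient after tau_0, and z of modulus 1 such that
    tau_(m+1) z^(m+1) is a positive multiple of tau_0. At t = sz the moduli of these two terms add
    up, and for small s they outweigh the tail. *)
Lemma power_series_max_modulus (R : realType) (T : R[i] -> R[i])
    (tau : nat -> R[i]) (B M delta : R) :
  0 < delta -> 0 <= M -> 0 <= B -> M * delta <= 2^-1 ->
  (forall t, cabs t <= delta -> forall k,
     cabs (T t - \sum_(i < k) t ^+ i * tau i) <= B * (cabs t * M) ^+ k) ->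
  (forall t, cabs t <= delta -> cabs (T t) <= cabs (tau 0%N)) ->
  forall t, cabs t <= delta -> T t = tau 0%N.
Proof.
move=> d0 M0 B0 Md HT HTb t0 t0d.
have [t00|t00] := eqVneq (tau 0%N) 0.
  apply/eqP; rewrite t00 -cabs_eq0; apply/eqP/le_anti; rewrite cabs_ge0 andbT.
  by have := HTb _ t0d; rewrite t00 cabs0.
have [H|/existsNP[i0 /eqP Hi0]] := pselect (forall i, tau i.+1 = 0).
  apply/eqP; rewrite -subr_eq0 -cabs_eq0; apply/eqP/le_anti; rewrite cabs_ge0 andbT.
  apply: (half_pow_le0 (B := B)) => k; have := HT _ t0d k.+1.
  rewrite big_ord_recl/= expr0 mul1r big1 ?addr0.
    move/le_trans; apply; rewrite ler_wpM2l//.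
    have tM : cabs t0 * M <= 2^-1.
      by rewrite (le_trans _ Md)// mulrC ler_wpM2l.
    apply: le_trans (_ : 2^-1 ^+ k.+1 <= _).
      by rewrite lerXn2r// nnegrE// mulr_ge0// cabs_ge0.
    by rewrite ler_wiXn2l// ?invf_le1// ler1n.
  by move=> i _; rewrite /bump/= add1n H mulr0.
have : exists i, tau i.+1 != 0 by exists i0.
move=> /ex_minnP[m tm minm].
have m0 i : (i < m)%N -> tau i.+1 = 0.
  by move=> im; apply/eqP; apply: contraTT im => /minm; rewrite -leqNgt.
pose z := m.+1.-root ((tau 0%N / tau m.+1) *
  (cabs (tau m.+1) / cabs (tau 0%N))%:C%C).
have a0 : 0 < cabs (tau 0%N) by rewrite cabs_gt0.
have am : 0 < cabs (tau m.+1) by rewrite cabs_gt0.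
have zE : tau m.+1 * z ^+ m.+1 =
    tau 0%N * (cabs (tau m.+1) / cabs (tau 0%N))%:C%C.
  by rewrite /z rootCK// mulrA mulrCA divff// mulr1.
have z1 : cabs z = 1.
  apply/eqP; rewrite -(@pexpr_eq1 _ _ m.+1) ?cabs_ge0//.
  apply/eqP/(mulfI (lt0r_neq0 am)); rewrite mulr1 -cabsX -cabsM zE cabsM cabsR.
    by rewrite mulrCA divff ?mulr1// gt_eqF.
  by rewrite divr_ge0// cabs_ge0.
pose N := B * M ^+ m.+2; have N0 : 0 <= N by rewrite mulr_ge0// exprn_ge0.
(* For this s the tail s^(m+2) N is smaller than s^(m+1) |tau_(m+1)|; N + 1 avoids a division by
   0. *)
pose s := Num.min delta (cabs (tau m.+1) / (2 * (N + 1))).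
have N1 : 0 < 2 * (N + 1) by rewrite mulr_gt0// ltr_wpDl.
have s0 : 0 < s by rewrite lt_min d0 divr_gt0.
have sd : s <= delta by rewrite ge_min lexx.
have sN : s * (2 * (N + 1)) <= cabs (tau m.+1).
  by rewrite -ler_pdivlMr// ge_min lexx orbT.
pose t := s%:C%C * z; have tE : cabs t = s by rewrite cabsM z1 mulr1 cabsR// ltW.
have td : cabs t <= delta by rewrite tE.
have := HT _ td m.+2; rewrite tE exprMn big_ord_recr big_ord_recl/= expr0 mul1r.
rewrite big1 ?addr0; last first.
  by move=> i _; rewrite /bump/= add1n m0 ?mulr0.
have E : tau 0%N + t ^+ m.+1 * tau m.+1 =
    tau 0%N * (1 + s ^+ m.+1 * (cabs (tau m.+1) / cabs (tau 0%N)))%:C%C.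
  rewrite /t exprMn -mulrA [z ^+ _ * _]mulrC zE rmorphD/= mulrDr mulr1.
  by rewrite -rmorphXn/= mulrCA -rmorphM.
rewrite E => H.
have x0 : 0 <= cabs (tau m.+1) / cabs (tau 0%N) by rewrite divr_ge0// cabs_ge0.
have : cabs (tau 0%N) * (1 + s ^+ m.+1 * (cabs (tau m.+1) / cabs (tau 0%N))) <=
    cabs (tau 0%N) + s ^+ m.+1 * (s * N).
  rewrite -[X in cabs (tau 0%N) * X <= _]cabsR; last first.
    by rewrite addr_ge0// mulr_ge0// exprn_ge0// ltW.
  rewrite -cabsM; set w := _ * _ in H *.
  rewrite -(subrK (T t) w) addrC (le_trans (cabsD _ _))// lerD ?HTb//.
  rewrite cabsB (le_trans H)// mulrCA exprSr -mulrA; exact: lexx.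
rewrite mulrDr mulr1 lerD2l mulrCA ler_pM2l ?exprn_gt0//.
rewrite mulrCA divff ?gt_eqF// mulr1.
have : s * N < s * (2 * (N + 1)) by rewrite ltr_pM2l//; lra.
by move=> h1 h2; exfalso; lra.
Qed.

(** * Eigenvalues and the trace *)

Section TraceRoots.
Variables (R : realType) (r : nat) (M : 'M[R[i]]_r.+1) (c : R[i]).

Lemma char_poly_split : exists2 zs : seq R[i], size zs = r.+1 &
  [/\ char_poly M = \prod_(z <- zs) ('X - z%:P), \tr M = \sum_(z <- zs) z &
    forall z, z \in zs -> root (char_poly M) z].
Proof.
have [zs E] := closed_field_poly_normal (char_poly M).
rewrite (monicP (char_poly_monic M)) scale1r in E.
have szs : size zs = r.+1.
  by apply/succn_inj; rewrite -(size_prod_XsubC zs id) -E size_char_poly.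
exists zs => //; split => //.
  have := @char_poly_trace _ _ M isT; have := @coefPn_prod_XsubC _ zs.
  by rewrite szs -E => /(_ isT) -> /oppr_inj.
by move=> z zzs; rewrite E root_prod_XsubC.
Qed.

Lemma trace_roots_const : (forall z, root (char_poly M) z -> z = c) ->
  \tr M = r.+1%:R * c.
Proof.
move=> H; have [zs szs [_ -> Hr]] := char_poly_split.
rewrite (eq_big_seq (fun=> c)); last by move=> z /Hr/H.
by rewrite big_const_seq count_predT szs iter_addr_0 mulr_natl.
Qed.

Lemma trace_roots_bound : (forall z, root (char_poly M) z -> cabs z <= cabs c) ->
  cabs (\tr M) <= cabs (r.+1%:R * c).
Proof.
move=> H; have [zs szs [_ -> Hr]] := char_poly_split.
rewrite (le_trans (cabs_sum _ _ _))// big_seq.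
apply: le_trans (_ : \sum_(z <- zs | z \in zs) cabs c <= _).
  by apply: ler_sum => z /Hr/H.
rewrite -big_seq big_const_seq count_predT szs iter_addr_0 cabsM -[leLHS]mulr_natl.
suff -> : cabs (r.+1%:R : R[i]) = r.+1%:R by [].
by rewrite -(rmorph_nat (real_complex R)) cabsR ?ler0n.
Qed.

(** Equality case of the triangle inequality: numbers of modulus at most |c| whose mean is c are all
    equal to c. *)
Lemma trace_roots_eq : (forall z, root (char_poly M) z -> cabs z <= cabs c) ->
  \tr M = r.+1%:R * c -> char_poly M = ('X - c%:P) ^+ r.+1.
Proof.
move=> H; have [zs szs [Ep -> Hr]] := char_poly_split => E; rewrite Ep.
suff Hz z : z \in zs -> z = c.
  rewrite (eq_big_seq (fun=> 'X - c%:P)); last by move=> z /Hz ->.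
  by rewrite big_const_seq count_predT szs iter_mulr_1.
have [c0|c0] := eqVneq c 0.
  move=> zzs; have := H _ (Hr _ zzs); rewrite c0 cabs0 => z0.
  apply/eqP; rewrite -cabs_eq0.
  by rewrite eq_le z0 cabs_ge0.
move=> zzs; pose F (i : 'I_(size zs)) := zs`_i / c.
have Fi i : true -> F i = 1.
  apply: (@normC_sum_upper _ _ xpredT F (fun=> 1)) => // [j _|].
    rewrite -cabsE lecR cabsM cabsV ler_pdivrMr ?cabs_gt0// mul1r H// Hr//.
    exact: mem_nth.
  rewrite /F -mulr_suml -(big_mkord xpredT (fun i => zs`_i)) -(big_nth 0 xpredT id) E.
  by rewrite mulfK// sumr_const card_ord szs.
have zi : (index z zs < size zs)%N by rewrite index_mem.
have := Fi (Ordinal zi) isT; rewrite /F/= nth_index// => /eqP.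
by rewrite -(inj_eq (mulIf c0)) divfK// mul1r => /eqP.
Qed.

End TraceRoots.

(** * Matrix representations depending on t *)

Section Curve.
Variables (R : realType) (A : comAlgType R[i]) (nm : A -> R).
Hypothesis hnm : banach_norm nm.
Variables (psi : A -> R[i]) (n : nat) (g : 'I_n -> A) (C : R).
Hypotheses (hpsi : is_character psi) (g0 : forall i, psi (g i) = 0)
  (C0 : 0 <= C)
  (gen : forall a, exists b : 'I_n -> A, a = (psi a)%:A + \sum_i b i * g i /\
    forall i, nm (b i) <= C * nm a).

(** Write a = sum c_i x_i + sum b_j w_j with the w_j in M^K. As u w_j = h z_j modulo P, the x_i span
    the remainders and sum b_j z_j is the quotient, with denominator u. *)
Lemma division_family_exists (P : set A) h u K : is_ideal P -> psi u = 1 ->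
  (forall a, ker_pow g K a -> idsum (principal h) P (u * a)) ->
  exists r (e : 'I_r -> A) v D, division_family nm psi P h e v D.
Proof.
move=> hP u1 HK; have [I [J [x [w [D [D0 Hw _ HD]]]]]] := ker_pow_gens hnm hpsi g0 C0 gen K.
have /choice[z Hz] : forall j, exists z, P (u * w j - h * z).
  by move=> j; have [_ [z _ ->] Pz] := HK _ (Hw j); exists z; rewrite mulrC [h * z]mulrC mulrC.
exists #|I|, (fun i => x (enum_val i)), u, (D + \sum_j D * nm (z j)).
have S0 : 0 <= \sum_j D * nm (z j).
  by apply: sumr_ge0 => j _; rewrite mulr_ge0 ?(nm_ge0 hnm).
split; [by rewrite u1 oner_neq0 | by rewrite addr_ge0 |] => a.
have [c [b [E Hc Hb]]] := HD a.
exists (fun i => c (enum_val i)), (\sum_j b j * z j); split.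
- rewrite -(big_enum_val (A := I) (fun i => c i *: x i)).
  rewrite {1}E addrAC subrr add0r !mulr_sumr -sumrB; apply: ideal_sum => // j _.
  rewrite (_ : _ - _ = b j * (u * w j - h * z j)); first exact: ideal_mull.
  by ring.
- move=> i; rewrite (le_trans (Hc _))// ler_wpM2r ?(nm_ge0 hnm)//.
  by rewrite lerDl.
- rewrite (le_trans (nm_sum hnm _ _ _))// mulrDl mulr_suml.
  rewrite ler_wpDl ?mulr_ge0 ?(nm_ge0 hnm)// ler_sum// => j _.
  rewrite (le_trans (nmM hnm _ _))// mulrAC ler_wpM2r ?(nm_ge0 hnm)//.
Qed.

(* S is the set of the characters which factor through one of the matrix
   representations [X t] below, for small t. *)
Lemma character_curve (J0 : set A) : is_ideal J0 -> unstable g J0 ->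
  exists S : set (A -> R[i]),
    [/\ forall chi, S chi -> is_character chi /\ forall a, J0 a -> chi a = 0,
      forall a, (forall chi, S chi -> cabs (chi a) <= cabs (psi a)) ->
        forall chi, S chi -> chi a = psi a &
      exists2 chi, S chi & chi <> psi].
Proof.
move=> hJ0 unstableJ0.
have [P [hP JP Ppsi prP [h [u [K [h0 Ph u1 HK]]]]]] :=
  unstable_prime hnm hpsi g0 C0 gen hJ0 unstableJ0.
have [r0 [e0 [v0 [D0 div0]]]] := division_family_exists hP u1 HK.
have [r [e [v [M [[v1 M0 div] ind]]]]] := division_family_min hnm hpsi hP Ppsi h0 div0.
have /choice[bd Hbd] : forall a, exists p : ('I_r.+1 -> R[i]) * A,
    [/\ P (v * (a - \sum_j p.1 j *: e j) - h * p.2),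
      forall j, cabs (p.1 j) <= M * nm a & nm p.2 <= M * nm a].
  by move=> a; have [b [d ?]] := div a; exists (b, d).
pose b a := (bd a).1; pose D a := (bd a).2.
have bP a : P (v * (a - \sum_j b a j *: e j) - h * D a) by have [] := Hbd a.
have bC a j : cabs (b a j) <= M * nm a by have [_ /(_ j)] := Hbd a.
have DC a : nm (D a) <= M * nm a by have [] := Hbd a.
(* M is now the constant of the division; |t| <= delta ensures |t| M <= 1/2. *)
pose delta := (2 * (M + 1))^-1.
have M1 : 0 < 2 * (M + 1) by rewrite mulr_gt0// ltr_wpDl.
have d0 : 0 < delta by rewrite invr_gt0.
have Md : M * delta <= 2^-1.
  by rewrite /delta ler_pdivrMr// mulrA mulVf ?mul1r ?lerDl// pnatr_eq0.
have tM t : cabs t <= delta -> cabs t * M <= 2^-1.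
  by move=> td; rewrite (le_trans _ Md)// mulrC ler_wpM2l.
have /choice[L HL] : forall t, exists L : A -> 'I_r.+1 -> R[i], cabs t <= delta ->
  [/\ forall k x y j, L (k *: x + y) j = k * L x j + L y j,
    forall a j, P a -> L a j = 0,
    forall i j, L (e i) j = (j == i)%:R,
    forall c d j, P (v * c - h * d) -> L c j = t * L d j &
    (forall f x j, L (f * x) j = \sum_i L x i * L (f * e i) j) /\
    forall a j k, cabs (L a j - \sum_(i < k) t ^+ i * tcoef b D i a j) <=
      2 * M * nm a * (cabs t * M) ^+ k].
  move=> t; have [td|td] := leP (cabs t) delta; last first.
    by exists (fun _ _ => 0).
  have [L HL] := evaluation_exists hnm hpsi hP prP Ph v1 M0 ind bP bC DC (tM _ td).
  by exists L.
(* The matrix of multiplication by a on the remainders at t; [eval_mul] makes it multiplicative in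
   a. *)
pose X t a : 'M[R[i]]_r.+1 := \matrix_(i, j) L t (a * e j) i.
have Xlin t k x y : cabs t <= delta -> X t (k *: x + y) = k *: X t x + X t y.
  move=> /HL[Llin _ _ _ _]; apply/matrixP => i j.
  by rewrite !mxE mulrDl -scalerAl Llin.
have XD t x y : cabs t <= delta -> X t (x + y) = X t x + X t y.
  by move=> td; rewrite -[x]scale1r Xlin// !scale1r.
have X0 t : cabs t <= delta -> X t 0 = 0.
  by move=> td; apply: (@addIr _ (X t 0)); rewrite -XD// !add0r.
have XM t x y : cabs t <= delta -> X t (x * y) = X t x * X t y.
  move=> /HL[_ _ _ _ [Lmul _]]; apply/matrixP => i j; rewrite !mxE -mulrA Lmul.
  by apply: eq_bigr => k _; rewrite !mxE mulrC.
have X1 t : cabs t <= delta -> X t 1 = 1.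
  by move=> /HL[_ _ Le _ _]; apply/matrixP => i j; rewrite !mxE mul1r Le.
have XP t a : cabs t <= delta -> P a -> X t a = 0.
  move=> /HL[_ LP _ _ _] Pa; apply/matrixP => i j; rewrite !mxE LP//.
  exact: ideal_mulr.
have XX t x m : cabs t <= delta -> X t (x ^+ m) = X t x ^+ m.
  by move=> td; elim: m => [|m IH]; rewrite ?expr0 ?X1// !exprS XM// IH.
have Xalg t k : cabs t <= delta -> X t k%:A = k%:M.
  by move=> td; rewrite -[_ *: _]addr0 Xlin// X0// addr0 X1// scalemx1.
have XB t x k : cabs t <= delta -> X t (x - k%:A) = X t x - k%:M.
  move=> td; apply: (@addIr _ (k%:M)); rewrite subrK -(Xalg t)// -XD//.
  by rewrite subrK.
have kerX t : cabs t <= delta -> is_ideal [set a | X t a = 0].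
  move=> td; split => /=; first exact: X0.
    by move=> x y Xx Xy; rewrite XD// Xx Xy addr0.
  by move=> x y Xy; rewrite XM// Xy mulr0.
pose S := [set chi | is_character chi /\ exists2 t, cabs t <= delta &
  forall a, X t a = 0 -> chi a = 0].
(* If 1 were in (f - z)A + ker X_t, the matrix X_t(f) - z would be invertible although z is an
   eigenvalue; so some character vanishes on this ideal. *)
have rootS t f z : cabs t <= delta -> root (char_poly (X t f)) z ->
    exists2 chi, is_character chi & chi f = z /\ forall a, X t a = 0 -> chi a = 0.
  move=> td; rewrite -eigenvalue_root_char => /eigenvalueP[w wE w0].
  have hI : is_ideal (idsum (principal (f - z%:A)) [set a | X t a = 0]).
    by apply: idsum_ideal; [exact: principal_ideal | exact: kerX].
  have [|chi hchi Hchi] := ideal_character hnm hI.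
    move=> [_ [y _ ->] /= Xy]; move/eqP: w0; apply.
    have : X t 1 = X t y * (X t f - z%:M).
      by rewrite -{1}(subrK (y * (f - z%:A)) 1) XD// Xy add0r XM// XB.
    have -> : X t y * (X t f - z%:M) = (X t f - z%:M) * X t y.
      rewrite mulrBl mulrBr -(XM t y f td) -(XM t f y td) [y * f]mulrC.
      congr (_ - _).
      by rewrite -[LHS]/(_ *m _) -[RHS]/(_ *m _) scalar_mxC.
    rewrite X1// => E; rewrite -[w]mulmx1 (_ : 1%:M = 1)// E.
    by rewrite -[X in _ *m X]/(_ *m _) mulmxA mulmxBr wE mul_mx_scalar subrr mul0mx.
  exists chi => //; split.
    apply/eqP; rewrite -subr_eq0 -[X in _ - X](char_alg hchi) -(charB hchi).
    apply/eqP/Hchi; apply: idsuml; [exact: kerX | exact: principal_id].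
  by move=> a Xa; apply: Hchi; apply: idsumr => //; exact: principal_ideal.
have cabs0d : cabs (0 : R[i]) <= delta by rewrite cabs0 ltW.
(* Each u g_i^K e_j is in hA + P, so g_i^K e_j has remainder 0 and X_0(g_i^K) = 0. Hence chi(g_i) =
   0, and the g_i generate ker psi. *)
have ker0 chi : is_character chi -> (forall a, X 0 a = 0 -> chi a = 0) -> chi = psi.
  move=> hchi H; apply/funext => a.
  have chig i : chi (g i) = 0.
    have KX : X 0 (g i ^+ K) = 0.
      have gK : ker_pow g K (g i ^+ K) by apply: (ker_powX hpsi g0 gen).
      apply/matrixP => k j; rewrite !mxE; have [_ _ _ Lsh _] := HL _ cabs0d.
      have [_ [z _ ->] Pz] := HK _ (ideal_mulr (e j) (ker_pow_ideal g K) gK).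
      have bw : b (g i ^+ K * e j) = fun=> 0.
        apply: (coef_uniq hpsi hP v1 ind bP (s := u) (d := z)).
          by rewrite u1 oner_neq0.
        rewrite big1 ?subr0; last by move=> l _; rewrite scale0r.
        by rewrite [h * z]mulrC.
      have := bP (g i ^+ K * e j); rewrite bw big1; last by move=> l _; rewrite scale0r.
      by rewrite subr0 => /Lsh ->; rewrite mul0r.
    have := H _ KX; rewrite charX// => /eqP; rewrite expf_eq0.
    by move=> /andP[_ /eqP].
  have [c [E _]] := gen a; rewrite {1}E charD// char_alg// char_sum// big1 ?addr0//.
  by move=> i _; rewrite charM// chig mulr0.
exists S; split.
- move=> chi [hchi [t td Ht]]; split => // a J0a; apply: Ht.
  by apply: XP => //; exact: JP.
- move=> a Ha.
  have rb t z : cabs t <= delta -> root (char_poly (X t a)) z -> cabs z <= cabs (psi a).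
    move=> td /(rootS _ _ _ td)[chi hchi [<- Ht]]; apply: Ha.
    by split => //; exists t.
  pose B := \sum_j 2 * M * nm (a * e j).
  pose tau k := \sum_j tcoef b D k (a * e j) j.
  have HT t : cabs t <= delta -> forall k,
      cabs (\tr (X t a) - \sum_(i < k) t ^+ i * tau i) <= B * (cabs t * M) ^+ k.
    move=> td k; have [_ _ _ _ [_ Lt]] := HL _ td.
    rewrite /mxtrace; under eq_bigr do rewrite mxE.
    rewrite (eq_bigr (fun i : 'I_k => \sum_j t ^+ i * tcoef b D i (a * e j) j)); last first.
      by move=> i _; rewrite mulr_sumr.
    rewrite exchange_big/= -sumrB (le_trans (cabs_sum _ _ _))// /B mulr_suml.
    by apply: ler_sum => j _; exact: Lt.
  have tr0 : \tr (X 0 a) = r.+1%:R * psi a.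
    apply: trace_roots_const => z /(rootS _ _ _ cabs0d)[chi hchi [<- H]].
    by rewrite (ker0 _ hchi H).
  have tau0 : tau 0%N = r.+1%:R * psi a.
    rewrite -tr0; apply/esym/eqP; rewrite -subr_eq0 -cabs_eq0 eq_le cabs_ge0 andbT.
    have := HT _ cabs0d 1%N; rewrite cabs0 mul0r expr1 mulr0.
    by rewrite big_ord1 expr0 mul1r.
  move=> chi [hchi [t td Ht]].
  have trt : \tr (X t a) = r.+1%:R * psi a.
    rewrite -tau0.
    apply: (power_series_max_modulus (T := fun t => \tr (X t a)) d0 M0 _ Md HT) => //.
      by apply: sumr_ge0 => j _; rewrite !mulr_ge0// (nm_ge0 hnm).
    by move=> s sd; rewrite tau0; apply: trace_roots_bound => z; exact: rb.
  have := trace_roots_eq (fun z => rb t z td) trt => Ech.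
  (* All eigenvalues of X_t(a) equal psi(a), so (a - psi(a))^(r+1) lies in ker X_t, where chi
     vanishes. *)
  have := Cayley_Hamilton (X t a); rewrite Ech rmorphXn/= rmorphB/= horner_mx_X horner_mx_C.
  have -> : X t a - (psi a)%:M = X t (a - (psi a)%:A).
    by rewrite XB.
  rewrite -XX// => /Ht; rewrite charX// charB// char_alg// => /eqP.
  by rewrite expf_eq0 /= subr_eq0 => /eqP.
- pose t : R[i] := delta%:C%C; have tE : cabs t = delta by rewrite cabsR// ltW.
  have td : cabs t <= delta by rewrite tE.
  have [|chi hchi Hchi] := ideal_character hnm (kerX _ td).
    by move=> /=; rewrite X1// => /eqP; rewrite oner_eq0.
  exists chi; first by split => //; exists t.
  (* h - tv lies in ker X_t, so chi(h) = t chi(v); for chi = psi this reads 0 = t psi(v), with both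
     factors non-zero. *)
  move=> chiE; have : chi (h - t *: v) = 0.
    apply: Hchi => /=; apply/matrixP => i j; rewrite !mxE mulrBl.
    have [Llin _ _ Lsh _] := HL _ td.
    rewrite addrC -scaleN1r -scalerAl scalerA Llin (Lsh (h * e j) (v * e j)).
      by rewrite mulN1r mulNr addNr.
    by rewrite mulrCA subrr; exact: ideal0.
  rewrite chiE charB// charZ// h0 sub0r => /eqP; rewrite oppr_eq0 mulf_eq0.
  by rewrite (negPf v1) orbF -cabs_eq0 tE gt_eqF.
Qed.

End Curve.

(** * Norm control on generators *)

Section CountablyGenerated.
Variables (R : realType) (A : comAlgType R[i]) (nm : A -> R).
Hypothesis hnm : banach_norm nm.

(** Baire's theorem. Otherwise one can choose shrinking balls, the centre of the ball N + 1 being at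
    distance at least its radius from Q_N; the centres converge to a point that is in no Q_N. *)
Lemma baire_norm (Q : nat -> set A) : (forall a, exists N, Q N a) ->
  exists N x r, 0 < r /\ forall y, nm (y - x) < r ->
    forall eps, 0 < eps -> exists2 z, Q N z & nm (y - z) < eps.
Proof.
move=> HQ; apply: contrapT => Hn.
have /choice[F HF] : forall p : nat * (A * R), exists q : A * R, 0 < p.2.2 ->
    [/\ nm (q.1 - p.2.1) <= p.2.2 / 4, 0 < q.2, q.2 <= p.2.2 / 2 &
      forall z, Q p.1 z -> q.2 <= nm (q.1 - z)].
  move=> [N [x r]] /=; have [r0|_] := ltP 0 r; last by exists (0, 0).
  apply: contrapT => H; apply: Hn; exists N, x, (r / 4); split; first by rewrite divr_gt0.
  move=> y yx eps eps0; apply: contrapT => Hz; apply: H.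
  exists (y, Num.min (r / 2) eps) => _ /=; split.
  - exact: ltW.
  - by rewrite lt_min eps0 divr_gt0.
  - by rewrite ge_min lexx.
  - move=> z Qz; rewrite ge_min; apply/orP; right; rewrite leNgt; apply/negP => zy.
    by apply: Hz; exists z.
pose st := fix st k : A * R := if k is k'.+1 then F (k', st k') else (0, 1).
have st0 k : 0 < (st k).2.
  by elim: k => [|k IH] //=; have [] := HF (k, st k) IH.
have stE k : [/\ nm ((st k.+1).1 - (st k).1) <= (st k).2 / 4,
    (st k.+1).2 <= (st k).2 / 2 & forall z, Q k z -> (st k.+1).2 <= nm ((st k.+1).1 - z)].
  by have [] := HF (k, st k) (st0 k).
have rN N k : (st (N + k)%N).2 <= (st N).2 * 2^-1 ^+ k.
  elim: k => [|k IH]; first by rewrite addn0 mulr1.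
  have [_ h _] := stE (N + k)%N; rewrite addnS (le_trans h)// exprSr mulrA.
  by rewrite ler_wpM2r.
have lim N : exists l, forall k,
    nm (l - (st (N + k)%N).1) <= 2 * ((st N).2 / 4) * 2^-1 ^+ k.
  apply: (nm_complete hnm (u := fun k => (st (N + k)%N).1)) => k.
  have [h _ _] := stE (N + k)%N; rewrite addnS (le_trans h)// mulrAC.
  by rewrite ler_wpM2r.
have [l Hl] := lim 0%N; have [N QN] := HQ l.
(* Restarting the sequence at N + 1 puts its limit within half a radius of the centre there; l'
   coincides with l. *)
have [l' Hl'] := lim N.+1.
have E : l - l' = 0.
  apply: (nm_half_eq0 hnm (B := 2 * ((st 0%N).2 / 4) + 2 * ((st N.+1).2 / 4))) => k.
  rewrite (_ : l - l' = (l - (st (N.+1 + k)%N).1) - (l' - (st (N.+1 + k)%N).1)); last by ring.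
  rewrite (le_trans (nmB hnm _ _))// mulrDl lerD ?Hl'//.
  apply: le_trans (Hl (N.+1 + k)%N) _; apply: ler_wpM2l.
    by rewrite mulr_ge0// divr_ge0.
  by apply: ler_wiXn2l; rewrite ?invf_le1// ?ler1n ?leq_addl.
have [_ _ /(_ _ QN)] := stE N; have := Hl' 0%N; rewrite addn0 mulr1.
move/eqP: E; rewrite subr_eq0 => /eqP <-; rewrite -(nmN hnm) opprB.
by have := st0 N.+1; move: (st N.+1).2 (nm _) => *; lra.
Qed.

Section Generators.
Variable psi : A -> R[i].
Hypothesis hpsi : is_character psi.

(** Successive approximation: each step halves the error, so the coefficients are sums of geometric
    series, of norm at most 2 C nm(a). *)
Lemma approx_gens_exact n (g : 'I_n -> A) C : 0 <= C -> (forall i, psi (g i) = 0) ->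
  (forall a, psi a = 0 -> exists b : 'I_n -> A, (forall i, nm (b i) <= C * nm a) /\
     nm (a - \sum_i b i * g i) <= 2^-1 * nm a) ->
  forall a, psi a = 0 -> exists b : 'I_n -> A, a = \sum_i b i * g i /\
    forall i, nm (b i) <= 2 * C * nm a.
Proof.
move=> C0 g0 H a a0.
have /choice[b Hb] : forall a, exists b : 'I_n -> A, psi a = 0 ->
    (forall i, nm (b i) <= C * nm a) /\ nm (a - \sum_i b i * g i) <= 2^-1 * nm a.
  move=> x; have [/H[b ?]|] := pselect (psi x = 0); first by exists b.
  by exists (fun=> 0).
pose st k := iter k (fun x => x - \sum_i b x i * g i) a.
have st0 k : psi (st k) = 0.
  elim: k => [|k IH] //=; rewrite charB// IH char_sum// big1 ?subr0// => i _.
  by rewrite charM// g0 mulr0.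
have stB k : nm (st k) <= nm a * 2^-1 ^+ k.
  elim: k => [|k IH]; first by rewrite mulr1.
  have [_ h] := Hb _ (st0 k); rewrite (le_trans h)// exprS mulrCA ler_wpM2l//.
pose u i k := \sum_(l < k) b (st l) i.
have /choice[l Hl] : forall i, exists l, forall k, nm (l - u i k) <= 2 * (C * nm a) * 2^-1 ^+ k.
  move=> i; apply: (nm_complete hnm) => k; rewrite /u big_ord_recr/= addrAC subrr add0r.
  have [h _] := Hb _ (st0 k); rewrite (le_trans (h i))// -mulrA ler_wpM2l//.
exists l; split; last first.
  by move=> i; have := Hl i 0%N; rewrite /u big_ord0 subr0 mulr1 mulrA.
apply/eqP; rewrite -subr_eq0; apply/eqP.
apply: (nm_half_eq0 hnm (B := nm a + \sum_i 2 * (C * nm a) * nm (g i))) => k.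
have E : a = st k + \sum_i u i k * g i.
  elim: k => [|k IH].
    by rewrite big1 ?addr0// => i _; rewrite /u big_ord0 mul0r.
  have -> : \sum_i u i k.+1 * g i = \sum_i u i k * g i + \sum_i b (st k) i * g i.
    by rewrite -big_split; apply: eq_bigr => i _; rewrite /u big_ord_recr/= mulrDl.
  rewrite {1}IH /=; move: (\sum_i u i k * g i) (\sum_i b (st k) i * g i) => x y.
  by ring.
rewrite {1}E -addrA -sumrB (le_trans (nmD hnm _ _))// mulrDl lerD//.
rewrite (le_trans (nm_sum hnm _ _ _))// mulr_suml ler_sum// => i _.
rewrite -mulrBl (le_trans (nmM hnm _ _))// mulrAC ler_wpM2r ?(nm_ge0 hnm)//.
by rewrite -(nmN hnm) opprB Hl.
Qed.

(** [U N] consists of the combinations of the first N generators plus a scalar, all coefficients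
    being bounded by N. By Baire some [U N] is dense in a ball; differences of its elements
    approximate small multiples of any a in ker psi, and [approx_gens_exact] makes this exact. *)
Lemma countably_generated_gens : countably_generated [set a | psi a = 0] ->
  exists n (g : 'I_n -> A) C, [/\ forall i, psi (g i) = 0, 0 <= C &
    forall a, exists b : 'I_n -> A, a = (psi a)%:A + \sum_i b i * g i /\
    forall i, nm (b i) <= C * nm a].
Proof.
move=> [S /countable_injP[f finj] kerE].
have S0 x : S x -> psi x = 0.
  move=> Sx; suff : [set a | psi a = 0] x by [].
  by rewrite kerE; exact: sub_gen_smallest.
(* s enumerates S along the injection f, with value 0 at the indices that f does not take. *)
have /choice[s Hs] : forall i : nat, exists x, psi x = 0 /\
    forall y, S y -> f y = i -> y = x.
  move=> i; have [[x [Sx fx]]|Hx] := pselect (exists x, S x /\ f x = i).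
    exists x; split; first exact: S0.
    by move=> y Sy fy; apply: finj; rewrite ?inE// fx.
  exists 0; split; first exact: char0.
  by move=> y Sy fy; case: Hx; exists y.
have s0 i : psi (s i) = 0 by have [] := Hs i.
have sS x : S x -> x = s (f x) by move=> Sx; have [_] := Hs (f x); exact.
pose I := [set a | exists N (b : nat -> A), a = \sum_(i < N) b i * s i].
have pad N M (b : nat -> A) : \sum_(i < N) b i * s i =
    \sum_(i < N + M) (if (i < N)%N then b i else 0) * s i.
  rewrite big_split_ord/= [X in _ = _ + X]big1 ?addr0.
    by apply: eq_bigr => i _; rewrite ltn_ord.
  by move=> i _; rewrite ltnNge leq_addr/= mul0r.
have hI : is_ideal I.
  split.
  - by exists 0%N, (fun=> 0); rewrite big_ord0.
  - move=> _ _ [N [b ->]] [M [c ->]].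
    exists (N + M)%N, (fun i => (if (i < N)%N then b i else 0) +
      (if (i < M)%N then c i else 0)).
    rewrite (pad N M b) (pad M N c) [(M + N)%N]addnC -big_split/=.
    by apply: eq_bigr => i _; rewrite mulrDl.
  - move=> a _ [N [b ->]]; exists N, (fun i => a * b i).
    by rewrite mulr_sumr; apply: eq_bigr => i _; rewrite mulrA.
have kerI a : psi a = 0 -> I a.
  move=> a0; have : [set a | psi a = 0] a by [].
  rewrite kerE; apply: smallest_sub => // x /sS ->.
  exists (f x).+1, (fun i => (i == f x)%:R); rewrite (bigD1 ord_max)//= eqxx mul1r.
  rewrite big1 ?addr0// => i /negPf; rewrite -val_eqE/= => ->.
  by rewrite mul0r.
(* The scalar c lets these sets cover the whole of A, to which Baire's theorem applies. *)
pose U (N : nat) := [set a | exists (c : R[i]) (b : nat -> A), [/\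
  a = c%:A + \sum_(i < N) b i * s i,
  cabs c <= N%:R & forall i, (i < N)%N -> nm (b i) <= N%:R]].
have HU a : exists N, U N a.
  have [|N [b E]] := kerI (a - (psi a)%:A).
    by rewrite charB// char_alg// subrr.
  have x0 : 0 <= cabs (psi a) + \sum_(i < N) nm (b i).
    by rewrite addr_ge0 ?cabs_ge0// sumr_ge0// => i _; exact: (nm_ge0 hnm).
  pose m := Num.bound (cabs (psi a) + \sum_(i < N) nm (b i)).
  have Hm : cabs (psi a) + \sum_(i < N) nm (b i) <= (N + m)%:R.
    by rewrite (le_trans (ltW (archi_boundP x0)))// ler_nat leq_addl.
  have sum0 (T : finType) (P : pred T) (F : T -> A) : 0 <= \sum_(i | P i) nm (F i).
    by rewrite sumr_ge0// => i _; exact: (nm_ge0 hnm).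
  exists (N + m)%N, (psi a), (fun i => if (i < N)%N then b i else 0); split.
  - rewrite -[LHS](subrK (psi a)%:A) E addrC; congr (_ + _).
    exact: pad.
  - by rewrite (le_trans _ Hm)// lerDl.
  - move=> i _; rewrite (le_trans _ Hm)//; case: ifPn => [iN|_].
      rewrite (bigD1 (Ordinal iN))//= addrCA lerDl.
      by rewrite addr_ge0 ?cabs_ge0.
    by rewrite (nm0 hnm).
have [N [x [r [r0 Hr]]]] := baire_norm HU.
pose C := 4 * N%:R / r; have C0 : 0 <= C by rewrite divr_ge0 ?mulr_ge0 ?ler0n// ltW.
have n1 : 0 < 1 + 2 * nm 1 by rewrite ltr_pwDl// mulr_ge0// (nm_ge0 hnm).
have ap a : psi a = 0 -> exists b : 'I_N -> A, (forall i, nm (b i) <= C * nm a) /\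
     nm (a - \sum_i b i * s i) <= 2^-1 * nm a.
  move=> a0; have [na|na] := leP (nm a) 0.
    have -> : a = 0 by apply: (nm0_eq0 hnm); apply/le_anti; rewrite na (nm_ge0 hnm).
    exists (fun=> 0); split; first by move=> i; rewrite (nm0 hnm) mulr0.
    by rewrite big1 ?subr0 ?(nm0 hnm) ?mulr0// => i _; rewrite mul0r.
  (* Scaled in this way, ka has norm r/2 and x + ka stays in the ball around x. *)
  pose k := r / (2 * nm a); have k0 : 0 < k by rewrite divr_gt0// mulr_gt0.
  have ka : k * nm a = r / 2 by rewrite /k; field; rewrite gt_eqF.
  pose eps := r / (8 * (1 + 2 * nm 1)).
  have eps0 : 0 < eps by rewrite divr_gt0// mulr_gt0.
  have [|z1 [c1 [b1 [E1 Hc1 Hb1]]] Hz1] := Hr (x + k%:C%C *: a) _ _ eps0.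
    rewrite addrAC subrr add0r (nmZ hnm) cabsR ?(ltW k0)// ka.
    by rewrite ltr_pdivrMr// ltr_pMr// ltr1n.
  have [|z2 [c2 [b2 [E2 Hc2 Hb2]]] Hz2] := Hr x _ _ eps0.
    by rewrite subrr (nm0 hnm).
  pose S12 := \sum_(i < N) (b1 i - b2 i) * s i.
  have S12E : z1 - z2 = (c1 - c2)%:A + S12.
    rewrite /S12; under eq_bigr do rewrite mulrBl.
    rewrite sumrB E1 E2 scalerBl; move: (\sum_(i < N) _) (\sum_(i < N) _) (c1%:A) (c2%:A).
    by move=> *; ring.
  have err : nm (k%:C%C *: a - (z1 - z2)) <= 2 * eps.
    rewrite (_ : _ - _ = (x + k%:C%C *: a - z1) - (x - z2)); last first.
      by move: (_ *: a) => y; ring.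
    by rewrite (le_trans (nmB hnm _ _))//; lra.
  (* psi kills a and the s_i, so its value on the error bounds c1 - c2, which can then be dropped;
     eps is chosen for a total error of r/4, half the norm of ka. *)
  have cE : cabs (c1 - c2) <= 2 * (2 * eps).
    have := char_bound hnm (k%:C%C *: a - (z1 - z2)) hpsi.
    rewrite charB// charZ// a0 mulr0 sub0r cabsN S12E charD// char_alg// char_sum//.
    rewrite big1 ?addr0; last by move=> i _; rewrite charM// s0 mulr0.
    by move/le_trans; apply; rewrite ler_wpM2l// -S12E.
  have main : nm (k%:C%C *: a - S12) <= r / 4.
    rewrite (_ : _ - _ = (k%:C%C *: a - (z1 - z2)) + (c1 - c2)%:A); last first.
      by rewrite S12E; move: (_ *: a) (_%:A) => *; ring.
    rewrite (le_trans (nmD hnm _ _))// (nmZ hnm).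
    apply: le_trans (_ : 2 * eps + 2 * (2 * eps) * nm 1 <= _).
      by rewrite lerD// ler_wpM2r ?(nm_ge0 hnm).
    rewrite (_ : r / 4 = 2 * eps * (1 + 2 * nm 1)); first by lra.
    by rewrite /eps; field; rewrite gt_eqF.
  exists (fun i => k^-1%:C%C *: (b1 i - b2 i)); split.
    move=> i; rewrite (nmZ hnm) cabsR ?invr_ge0 ?(ltW k0)//.
    rewrite ler_pdivrMl//.
    rewrite (_ : k * (C * nm a) = 2 * N%:R); last first.
      by rewrite mulrCA ka /C; field; rewrite gt_eqF.
    rewrite (le_trans (nmB hnm _ _))//; have := Hb1 i (ltn_ord i).
    by have := Hb2 i (ltn_ord i); lra.
  rewrite (_ : _ - _ = k^-1%:C%C *: (k%:C%C *: a - S12)); last first.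
    rewrite scalerBr scalerA -rmorphM/= mulVf ?gt_eqF// scale1r; congr (_ - _).
    by rewrite /S12 scaler_sumr; apply: eq_bigr => i _; rewrite scalerAl.
  rewrite (nmZ hnm) cabsR ?invr_ge0 ?(ltW k0)// ler_pdivrMl//.
  by rewrite mulrCA ka (le_trans main)//; lra.
have HH := approx_gens_exact C0 (g := fun i : 'I_N => s i) (fun i => s0 i) ap.
exists N, (fun i => s i), (2 * C * (1 + 2 * nm 1)); split => //.
  by apply: mulr_ge0; [exact: mulr_ge0 | exact: ltW].
move=> a; have [|b [E Hb]] := HH (a - (psi a)%:A).
  by rewrite charB// char_alg// subrr.
exists b; split; first by rewrite -E addrC subrK.
move=> i; apply: le_trans (Hb i) _; rewrite -[leRHS]mulrA.
apply: ler_wpM2l; first exact: mulr_ge0.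
rewrite (le_trans (nmB hnm _ _))// mulrDl mul1r lerD2l (nmZ hnm).
by rewrite mulrAC ler_wpM2r ?(nm_ge0 hnm)// (char_bound hnm).
Qed.

End Generators.
End CountablyGenerated.

(** * Compactness of the character space *)

Section BanachAlgebra.
Variables (R : realType) (A : comBanachAlgType R[i]).

Definition rnorm (a : A) : R := complex.Re `|a|.

Lemma rnormE a : (rnorm a)%:C%C = `|a|.
Proof. by rewrite /rnorm RRe_real// ger0_real. Qed.

Lemma rnorm_ge0 a : 0 <= rnorm a.
Proof. by rewrite -ler0c rnormE. Qed.

Lemma rnormD a b : rnorm (a + b) <= rnorm a + rnorm b.
Proof. by rewrite -lecR rmorphD/= !rnormE ler_normD. Qed.

Lemma rnormB a b : rnorm (a - b) = rnorm (b - a).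
Proof. by rewrite /rnorm distrC. Qed.

Lemma rnorm_geometric (u : nat -> A) B :
  (forall k, rnorm (u k.+1 - u k) <= B * 2^-1 ^+ k) ->
  forall k m, rnorm (u (k + m)%N - u k) <= 2 * B * 2^-1 ^+ k.
Proof.
move=> Hu k m; have B0 : 0 <= B.
  by have := Hu 0%N; rewrite mulr1; apply: le_trans; exact: rnorm_ge0.
have : rnorm (u (k + m)%N - u k) <= 2 * B * 2^-1 ^+ k - 2 * B * 2^-1 ^+ (k + m).
  elim: m => [|m IH]; first by rewrite addn0 !subrr /rnorm normr0.
  rewrite addnS -[u _](subrK (u (k + m)%N)) -addrA (le_trans (rnormD _ _))//.
  by have h := Hu (k + m)%N; rewrite [_ ^+ (k + m).+1]exprS; lra.
move/le_trans; apply; rewrite gerBl mulr_ge0// ?exprn_ge0//; lra.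
Qed.

Lemma rnorm_complete (u : nat -> A) B :
  (forall k, rnorm (u k.+1 - u k) <= B * 2^-1 ^+ k) ->
  exists l, forall k, rnorm (l - u k) <= 2 * B * 2^-1 ^+ k.
Proof.
move=> Hu; have Hg := rnorm_geometric Hu.
have cu : cvg (u @ \oo).
  apply: cauchy_cvg; apply: cauchy_exP => e e0.
  have [k Hk] : exists k, 2 * B * 2^-1 ^+ k < complex.Re e.
    by apply: half_pow_lt; rewrite -ltcR RRe_real// gtr0_real.
  exists (u k); exists k => // m /= km.
  rewrite -ball_normE /= -rnormE -[e]RRe_real ?gtr0_real// ltcR rnormB.
  by rewrite -(subnKC km) (le_lt_trans _ Hk).
exists (lim (u @ \oo)) => k; rewrite leNgt; apply/negP => Hlt.
set l := lim _ in Hlt *; pose e := rnorm (l - u k) - 2 * B * 2^-1 ^+ k.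
have e0 : 0 < e by rewrite subr_gt0.
have : \forall n \near \oo, ball l e%:C%C (u n).
  by apply: cu; apply: nbhsx_ballx; rewrite ltcR.
move=> [N _ HN]; have := HN (k + N)%N (leq_addl _ _).
rewrite -ball_normE /= -rnormE ltcR; have := Hg k N.
have : rnorm (l - u k) <= rnorm (l - u (k + N)%N) + rnorm (u (k + N)%N - u k).
  by rewrite (le_trans _ (rnormD _ _))// addrA subrK.
by rewrite /e; move=> *; lra.
Qed.

Lemma rnorm_banach : banach_norm (A := A) rnorm.
Proof.
split.
- exact: rnorm_ge0.
- exact: rnormD.
- by move=> a b; rewrite -lecR rmorphM/= !rnormE; exact: banach_normM.
- by move=> k a; apply: complexI; rewrite rmorphM/= !rnormE cabsE; exact: normrZ.
- move=> a a0; apply/eqP; rewrite -normr_eq0 -rnormE a0 //.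
- exact: rnorm_complete.
Qed.

Lemma character_set_val (phi : characters A) : is_character (A := A) (set_val phi).
Proof. exact: set_valP phi. Qed.

Lemma gelfand_continuous (a : A) : continuous (gelfand a : characters A -> R[i]).
Proof.
move=> phi; apply: (@continuous_comp _ _ _ (set_val : characters A -> {ptws A -> R[i]}) (proj a)).
  exact: initial_continuous.
exact: proj_continuous.
Qed.

Lemma cabs_gelfand_continuous (a : A) :
  continuous (fun phi : characters A => cabs (gelfand a phi)).
Proof.
move=> phi; apply: (@continuous_comp _ _ _ (gelfand a : characters A -> R[i])).
  exact: gelfand_continuous.
exact: cabs_continuous.
Qed.

Section ContinuousComplex.
Variable X : topologicalType.
Implicit Types p q : X -> R[i].

Lemma continuous_cabsP p : continuous p <->
  forall x (e : R), 0 < e -> \forall y \near x, cabs (p x - p y) < e.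
Proof.
split=> [cp x e e0|H x U /nbhs_cabsP[e e0 eU]].
  by apply: (cp x [set z | cabs (p x - z) < e]); apply/nbhs_cabsP; exists e.
by apply: filterS (H x e e0) => y; exact: eU.
Qed.

Lemma continuous_cabsB p q : continuous p -> continuous q ->
  continuous (fun x => p x - q x).
Proof.
move=> /continuous_cabsP cp /continuous_cabsP cq; apply/continuous_cabsP => x e e0.
have e2 : 0 < e / 2 by rewrite divr_gt0.
apply: filterS2 (cp x _ e2) (cq x _ e2) => y hp hq.
rewrite (_ : _ - _ = (p x - p y) - (q x - q y)); last by ring.
by rewrite (le_lt_trans (cabsD _ _))// cabsN; lra.
Qed.

Lemma continuous_cabsM p q : continuous p -> continuous q ->
  continuous (fun x => p x * q x).
Proof.
move=> /continuous_cabsP cp /continuous_cabsP cq; apply/continuous_cabsP => x e e0.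
pose m := cabs (p x) + cabs (q x) + 1.
have m1 : 1 <= m by rewrite /m lerDr addr_ge0 ?cabs_ge0.
have m0 : 0 < m by exact: lt_le_trans m1.
pose d := Num.min 1 (e / (2 * m)).
have d0 : 0 < d by rewrite lt_min ltr01 divr_gt0// mulr_gt0.
have d1 : d <= 1 by rewrite ge_min lexx.
have dm : d * (2 * m) <= e by rewrite -ler_pdivlMr ?mulr_gt0// ge_min lexx orbT.
apply: filterS2 (cp x _ d0) (cq x _ d0) => y hp hq.
rewrite (_ : _ - _ = (p x - p y) * (q x - (q x - q y)) + p x * (q x - q y)); last by ring.
rewrite (le_lt_trans (cabsD _ _))// !cabsM.
have h1 : cabs (q x - (q x - q y)) <= m.
  rewrite (le_trans (cabsD _ _))// cabsN /m; have := cabs_ge0 (p x); lra.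
have h2 : cabs (p x) <= m by rewrite /m; have := cabs_ge0 (q x); lra.
have h3 : cabs (p x - p y) * cabs (q x - (q x - q y)) <= cabs (p x - p y) * m.
  by rewrite ler_wpM2l// cabs_ge0.
have h4 : cabs (p x) * cabs (q x - q y) <= m * cabs (q x - q y).
  by rewrite ler_wpM2r// cabs_ge0.
have h5 : cabs (p x - p y) * m < d * m by rewrite ltr_pM2r.
have h6 : m * cabs (q x - q y) < d * m by rewrite mulrC ltr_pM2r.
lra.
Qed.

Lemma continuous_cabs_cst (k : R[i]) : continuous (fun _ : X => k).
Proof. by move=> x; exact: cvg_cst. Qed.

End ContinuousComplex.

Lemma closed_zeroset (X : topologicalType) (p : X -> R[i]) :
  continuous p -> closed [set x | p x = 0].
Proof.
move=> cp; rewrite (_ : [set _ | _] = p @^-1` [set 0]).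
  apply: closed_comp; first by move=> x _; exact: cp.
  rewrite (_ : [set 0] = (@cabs R) @^-1` [set 0]).
    by apply: closed_comp => [z _|]; [exact: cabs_continuous|exact: closed_eq].
  by apply/seteqP; split => z /= => [->|/eqP]; rewrite ?cabs0// cabs_eq0 => /eqP.
by [].
Qed.

(** Being non-zero somewhere is not a closed condition; for multiplicative f it is replaced by f(1)
    = 1. *)
Lemma closed_characters : closed (characters A).
Proof.
pose ev (a : A) (f : {ptws A -> R[i]}) : R[i] := f a.
have cev a : continuous (ev a) by move=> f; exact: proj_continuous.
pose L (p : R[i] * (A * A)) := [set f : {ptws A -> R[i]} |
  ev (p.1 *: p.2.1 + p.2.2) f - (p.1 * ev p.2.1 f + ev p.2.2 f) = 0].
pose M (p : A * A) := [set f : {ptws A -> R[i]} |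
  ev (p.1 * p.2) f - ev p.1 f * ev p.2 f = 0].
pose N := [set f : {ptws A -> R[i]} | ev 1 f - 1 = 0].
have -> : characters A = (\bigcap_p L p `&` \bigcap_p M p) `&` N.
  apply/seteqP; split => f.
    move=> hf; split; [split|].
    - by move=> [k [a b]] _; have [h _ _] := hf; rewrite /L/= /ev h subrr.
    - by move=> [a b] _; have [_ h _] := hf; rewrite /M/= /ev h subrr.
    - by rewrite /N/= /ev (char1 (A := A) hf) subrr.
  move=> [[HL HM] HN]; split.
  - by move=> k a b; apply/eqP; rewrite -subr_eq0; apply/eqP/(HL (k, (a, b))).
  - by move=> a b; apply/eqP; rewrite -subr_eq0; apply/eqP/(HM (a, b)).
  - by exists 1; have /eqP := HN; rewrite subr_eq0 => /eqP; rewrite /ev => ->; exact: oner_neq0.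
apply: closedI; [apply: closedI|].
- apply: closed_bigI => p _; apply: closed_zeroset.
  rewrite (_ : (fun _ => _) =
      (fun f => ev (p.1 *: p.2.1 + p.2.2) f - p.1 * ev p.2.1 f - ev p.2.2 f)).
    apply: continuous_cabsB; last exact: cev.
    apply: continuous_cabsB; first exact: cev.
    by apply: continuous_cabsM; [exact: continuous_cabs_cst | exact: cev].
  by apply/funext => f; rewrite opprD addrA.
- apply: closed_bigI => p _; apply: closed_zeroset.
  by apply: continuous_cabsB; [|apply: continuous_cabsM]; exact: cev.
- apply: closed_zeroset.
  by apply: continuous_cabsB; [exact: cev | exact: continuous_cabs_cst].
Qed.

Lemma compact_characters : compact [set: characters A].
Proof.
pose K := [set f : {ptws A -> R[i]} | forall a, cabs (f a) <= 2 * rnorm a].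
have cK : compact K.
  exact: (@tychonoff A (fun=> R[i]) (fun a => [set z | cabs z <= 2 * rnorm a])
    (fun a => @compact_disc R (2 * rnorm a))).
have cC : compact (characters A).
  apply: (subclosed_compact closed_characters cK) => f hf a.
  exact: (char_bound rnorm_banach).
(* Transfer to the subspace type: the filter is pushed forward along [set_val], and the cluster
   point found in the product is lifted back. *)
move=> F PF FT.
have FC : (set_val @ F) (characters A).
  by apply: (@filterS _ F _ setT) => // phi _; exact: (character_set_val phi).
have [f [hf clf]] := cC _ (fmap_proper_filter _ PF) FC.
exists (SigSub (mem_set hf)); split => // U V FU [W [[Z oZ <-] /= Zf ZV]].
have FU' : (set_val @ F) (set_val @` U).
  by apply: (@filterS _ F _ U) => // phi Uphi; exists phi.
have [_ [[phi Uphi <-] Zphi]] := clf _ _ FU' (open_nbhs_nbhs (conj oZ Zf)).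
by exists phi; split => //; exact: ZV.
Qed.

End BanachAlgebra.

(** * Finite-dimensional idempotents *)

Section SpanFiniteDimensional.
Variables (K : fieldType) (V : lmodType K).

Definition spans n (x : 'I_n -> V) :=
  forall a, exists c : 'I_n -> K, a = \sum_i c i *: x i.

Lemma spans_elim n (x : 'I_n.+1 -> V) (c : 'I_n.+1 -> K) j0 :
  spans x -> \sum_i c i *: x i = 0 -> c j0 != 0 ->
  spans (fun i => x (lift j0 i)).
Proof.
move=> Hx c0 cj a; have [d ->] := Hx a.
exists (fun i => d (lift j0 i) - d j0 / c j0 * c (lift j0 i)).
under [RHS]eq_bigr do rewrite scalerBl -scalerA.
rewrite sumrB -scaler_sumr (bigD1_ord j0)//= addrC; congr (_ + _).
move: c0; rewrite (bigD1_ord j0)//= => /eqP; rewrite addrC addr_eq0 => /eqP ->.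
by rewrite scalerN opprK scalerA divfK.
Qed.

Lemma spans_finite_dimensional n (x : 'I_n -> V) : spans x -> finite_dimensional V.
Proof.
move=> Hx; have : exists n, `[< exists x : 'I_n -> V, spans x >].
  by exists n; apply/asboolP; exists x.
move=> {n x Hx} /ex_minnP[n /asboolP[x Hx] minn].
have free c : \sum_i c i *: x i = 0 -> forall i, c i = 0.
  case: n => [|n] in x Hx minn c *; first by move=> _ [].
  move=> c0 i; apply/eqP; apply: contraT => ci.
  have /minn : `[< exists x : 'I_n -> V, spans x >].
    by apply/asboolP; exists (fun j => x (lift i j)); exact: spans_elim c0 ci.
  by rewrite ltnn.
have /choice[c Hc] := Hx.
have uniq a d : a = \sum_i d i *: x i -> c a = d.
  move=> E; apply/funext => i; apply/eqP; rewrite -subr_eq0; apply/eqP.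
  apply: (free (fun i => c a i - d i)); under eq_bigr do rewrite scalerBl.
  by rewrite sumrB -Hc -E subrr.
exists n; constructor; exists (fun a => \row_i c a i).
  move=> k a b; apply/rowP => i; rewrite !mxE.
  rewrite (uniq _ (fun i => k * c a i + c b i))//.
  under eq_bigr do rewrite scalerDl -scalerA.
  by rewrite big_split/= -scaler_sumr -!Hc.
exists (fun w : 'rV_n => \sum_i w 0 i *: x i) => [a|w].
  by under eq_bigr do rewrite mxE; rewrite -Hc.
by apply/rowP => i; rewrite !mxE (uniq _ (fun i => w 0 i)).
Qed.

End SpanFiniteDimensional.

Section FiniteIdempotents.
Variables (R : realType) (A : comAlgType R[i]).

(* The idempotents e such that eA is finite-dimensional. *)
Definition fin_idem (e : A) := e * e = e /\
  exists (I : finType) (x : I -> A), forall a, exists c : I -> R[i],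
    e * a = \sum_i c i *: x i.

Definition fin_ideal : set A := [set a | exists2 e, fin_idem e & e * a = a].

Lemma fin_idem0 : fin_idem 0.
Proof.
split; first by rewrite mul0r.
by exists void, (fun=> 0) => a; exists (fun=> 0); rewrite mul0r big1.
Qed.

(** The complement of e + f - ef is (1 - e)(1 - f), and (e + f - ef)a = ea + f(a - ea) shows that
    the ranges of e and f span its range. Joins make these idempotents directed, hence [fin_ideal]
    an ideal. *)
Lemma fin_idem_join e f : fin_idem e -> fin_idem f -> fin_idem (e + f - e * f).
Proof.
move=> [ee [I [x Hx]]] [ff [K [y Hy]]]; split.
  have -> : (e + f - e * f) * (e + f - e * f) = e * e + f * f + e * f *+ 2 -
      (e * e) * f *+ 2 - e * (f * f) *+ 2 + (e * e) * (f * f) by ring.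
  by rewrite ee ff; ring.
exists (I + K)%type, (fun z => match z with inl i => x i | inr k => y k end) => a.
have [c Hc] := Hx a; have [d Hd] := Hy (a - e * a).
exists (fun z => match z with inl i => c i | inr k => d k end).
by rewrite big_sumType/= -Hc -Hd; ring.
Qed.

Lemma fin_idem_joinl e f : fin_idem e -> (e + f - e * f) * e = e.
Proof. by move=> [ee _]; rewrite mulrBl mulrDl ee mulrAC ee [f * e]mulrC addrK. Qed.

Lemma fin_idem_joinr e f : fin_idem f -> (e + f - e * f) * f = f.
Proof.
by move=> [ff _]; rewrite mulrBl mulrDl ff -mulrA ff addrAC subrr add0r.
Qed.

Lemma fin_ideal_ideal : is_ideal fin_ideal.
Proof.
split.
- by exists 0; [exact: fin_idem0 | rewrite mul0r].
- move=> a b [e he ea] [f hf fb]; exists (e + f - e * f).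
    exact: fin_idem_join.
  by rewrite mulrDr -{1}ea mulrA fin_idem_joinl// ea -{1}fb mulrA fin_idem_joinr// fb.
- by move=> a b [e he eb]; exists e => //; rewrite mulrCA eb.
Qed.

Lemma fin_idem_in e : fin_idem e -> fin_ideal e.
Proof. by move=> he; exists e => //; case: he. Qed.

Lemma fin_ideal1 : fin_ideal 1 -> finite_dimensional A.
Proof.
move=> [e [_ [I [x Hx]]]]; rewrite mulr1 => e1.
apply: (@spans_finite_dimensional _ _ #|I| (fun i => x (enum_val i))) => a.
have [c Hc] := Hx a; exists (fun i => c (enum_val i)).
by rewrite -(big_enum_val (A := I) (fun i => c i *: x i)) -[LHS]mul1r -e1 Hc.
Qed.

End FiniteIdempotents.

(** * Faces of a set of characters *)

Section Faces.
Variables (R : realType) (A : comBanachAlgType R[i]).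
Notation Phi := (characters A).
Implicit Types (F H S U : set Phi) (chi psi : Phi) (a f : A).

Definition gabs a chi : R := cabs (gelfand a chi).

Lemma gabs_continuous a : continuous (gabs a).
Proof. exact: cabs_gelfand_continuous. Qed.

Lemma gabs_bound a chi : gabs a chi <= 2 * rnorm a.
Proof. exact: (char_bound (@rnorm_banach R A) a (character_set_val chi)). Qed.

Lemma gabsM a b chi : gabs (a * b) chi = gabs a chi * gabs b chi.
Proof.
by rewrite /gabs -cabsM /gelfand (charM (character_set_val chi)).
Qed.

Lemma gabsZ (k : R[i]) a chi : gabs (k *: a) chi = cabs k * gabs a chi.
Proof. by rewrite /gabs -cabsM /gelfand (charZ (character_set_val chi)). Qed.

Lemma gabsX a n chi : gabs (a ^+ n) chi = gabs a chi ^+ n.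
Proof. by rewrite /gabs -cabsX /gelfand (charX (character_set_val chi)). Qed.

Lemma gabs1 chi : gabs 1 chi = 1.
Proof. by rewrite /gabs /gelfand (char1 (character_set_val chi)) cabs1. Qed.

Lemma gabs_lt_open a (x : R) : open [set chi | gabs a chi < x].
Proof.
rewrite (_ : [set _ | _] = gabs a @^-1` [set y | y < x])//.
by apply: open_comp => [chi _|]; [exact: gabs_continuous | exact: open_lt].
Qed.

Lemma gabs_eq_closed a (x : R) : closed [set chi | gabs a chi = x].
Proof.
rewrite (_ : [set _ | _] = gabs a @^-1` [set x])//.
by apply: closed_comp => [chi _|]; [exact: gabs_continuous | exact: closed_eq].
Qed.

Lemma closed_compact_characters F : closed F -> compact F.
Proof. by move=> cF; apply: (subclosed_compact cF (@compact_characters R A)). Qed.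

Lemma gabs_max F a : closed F -> F !=set0 ->
  exists2 chi, F chi & forall chi', F chi' -> gabs a chi' <= gabs a chi.
Proof.
move=> cF F0.
have [|chi Fchi H] := @compact_EVT_max _ _ (gabs a) F F0 (closed_compact_characters cF).
  by apply: continuous_subspaceT; exact: gabs_continuous.
exists chi; first exact: set_mem.
by move=> chi' /mem_set; exact: H.
Qed.

(* Satisfied by the sets S given by [character_curve]. *)
Definition max_modulus_at S psi := forall a,
  (forall chi, S chi -> gabs a chi <= gabs a psi) ->
  forall chi, S chi -> gelfand a chi = gelfand a psi.

(* The last clause says that F is approximately a peak set for the functions
   of A on H. *)
Definition face H F := [/\ F !=set0, closed F, F `<=` H,
  forall psi S, F psi -> S `<=` H -> max_modulus_at S psi -> S `<=` F &
  forall U (eps : R), open U -> F `<=` U -> 0 < eps -> exists f,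
    [/\ forall chi, H chi -> gabs f chi <= 1,
      forall chi, F chi -> 1 - eps <= gabs f chi &
      forall chi, H chi -> ~ U chi -> gabs f chi <= eps]].

Lemma face_self H : closed H -> H !=set0 -> face H H.
Proof.
move=> cH H0; split => // U eps _ HU eps0; exists 1; split.
- by move=> chi _; rewrite gabs1.
- by move=> chi _; rewrite gabs1 gerBl ltW.
- by move=> chi /HU.
Qed.

(** Faces are written H minus C, so that a decreasing chain of faces is an increasing chain of sets
    C, as Zorn's lemma for unions requires. Compactness is applied with the filter of final segments
    of D. *)
Lemma compact_chain_subset H (D : set (set Phi)) U : D !=set0 -> total_on D subset ->
  (forall C, D C -> closed (H `\` C)) -> open U ->
  H `\` \bigcup_(C in D) C `<=` U -> exists2 C, D C & H `\` C `<=` U.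
Proof.
move=> [C1 DC1] totD cD oU HU.
pose Fil : set_system (set Phi) := [set Q | exists2 C0, D C0 & forall C, D C -> C0 `<=` C -> Q C].
have FilF : Filter Fil.
  split.
  - by exists C1.
  - move=> P Q [C2 DC2 HP] [C3 DC3 HQ]; have [C23|C32] := totD _ _ DC2 DC3.
      exists C3 => // C DC C3C; split; last exact: HQ.
      by apply: HP => //; exact: subset_trans C3C.
    exists C2 => // C DC C2C; split; first exact: HP.
    by apply: HQ => //; exact: subset_trans C2C.
  - by move=> P Q PQ [C0 DC0 HP]; exists C0 => // C DC C0C; apply: PQ; exact: HP.
have /compact_near_coveringP := @compact_characters R A.
move=> /(_ _ Fil (fun C chi => (H `\` C) chi -> U chi) FilF)[].
  move=> chi _; have [Uchi|nU] := pselect (U chi).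
    exists (U, setT); first by split => /=; [exact: open_nbhs_nbhs | exists C1].
    by move=> [x C] [].
  have [C0 DC0 nC0] : exists2 C0, D C0 & ~ (H `\` C0) chi.
    have [Hchi|nH] := pselect (H chi); last by exists C1 => // -[].
    apply: contrapT => HC; apply: nU; apply: HU; split => // -[C DC Cchi].
    by apply: HC; exists C => // -[].
  exists (~` (H `\` C0), [set C | D C /\ C0 `<=` C]).
    split => /=; last by exists C0.
    by apply: open_nbhs_nbhs; split => //; exact/closed_openC/cD.
  by move=> [x C] [/= nx [DC C0C]] [Hx nCx]; case: nx; split => // /C0C.
move=> C0 DC0 HC; exists C0 => // chi; apply: (HC C0) => //.
Qed.

Lemma face_chain H (D : set (set Phi)) : closed H -> H !=set0 -> total_on D subset ->
  (forall C, D C -> face H (H `\` C)) -> face H (H `\` \bigcup_(C in D) C).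
Proof.
move=> cH H0 totD HD; have [D0|D0] := pselect (D !=set0); last first.
  rewrite (_ : \bigcup_(C in D) C = set0) ?setD0; first exact: face_self.
  by apply/seteqP; split => // x [C DC _]; case: D0; exists C.
have cD C : D C -> closed (H `\` C) by move=> /HD[].
have sub C : D C -> H `\` \bigcup_(C in D) C `<=` H `\` C.
  by move=> DC x [Hx nx]; split => // Cx; apply: nx; exists C.
split.
- apply: contrapT => H0'; have [|C DC HC] := compact_chain_subset D0 totD cD (@open0 _).
    by move=> x Hx; case: H0'; exists x.
  by have [[x /HC]] := HD _ DC.
- rewrite (_ : _ `\` _ = \bigcap_(C in D) (H `\` C)); first exact: closed_bigI.
  apply/seteqP; split => [x Hx C DC|x Hx]; first exact: sub.
  have [C DC] := D0; have [Hx1 _] := Hx _ DC; split => // -[C' DC' C'x].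
  by have [] := Hx _ DC'.
- by move=> x [].
- move=> psi S Hpsi SH mS chi Schi.
  have HC C : D C -> (H `\` C) chi.
    by move=> DC; have [_ _ _ h _] := HD _ DC; exact: (h psi S (sub _ DC _ Hpsi)).
  by split; [exact: SH | move=> [C DC Cchi]; have [] := HC _ DC].
- move=> U eps oU HU eps0; have [C DC HC] := compact_chain_subset D0 totD cD oU HU.
  have [_ _ _ _ h] := HD _ DC; have [f [f1 f2 f3]] := h _ _ oU HC eps0.
  by exists f; split => // chi Hchi; apply: f2; exact: sub.
Qed.

(* If f peaks approximately on F, then f a^k, suitably scaled, peaks
   approximately where |a| is maximal on F. *)
Lemma face_argmax H F a : face H F -> (forall chi, F chi -> 0 < gabs a chi) ->
  face H [set chi | F chi /\ forall chi', F chi' -> gabs a chi' <= gabs a chi].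
Proof.
move=> [F0 cF FH F1 F2] a0; have [x0 Fx0 Hx0] := gabs_max a cF F0.
pose m := gabs a x0; have m0 : 0 < m by exact: a0.
have E : [set chi | F chi /\ forall chi', F chi' -> gabs a chi' <= gabs a chi] =
    F `&` [set chi | gabs a chi = m].
  apply/seteqP; split => chi /= [Fchi h]; split => //.
    by apply/le_anti; rewrite Hx0//= h.
  by move=> chi' /Hx0; rewrite h.
rewrite E; split.
- by exists x0.
- by apply: closedI => //; exact: gabs_eq_closed.
- by move=> chi [/FH].
- move=> psi S [Fpsi psim] SH mS chi Schi.
  have SF : S `<=` F by exact: F1 mS.
  split; first exact: SF.
  rewrite /= -psim /gabs (mS a)// => chi' /SF /Hx0.
  by rewrite psim.
- move=> U eps oU FU eps0.
  pose a' := m^-1%:C%C *: a.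
  have a'E chi : gabs a' chi = m^-1 * gabs a chi.
    by rewrite gabsZ cabsR// invr_ge0 ltW.
  have a'1 chi : F chi -> gabs a chi = m -> gabs a' chi = 1.
    by move=> _ h; rewrite a'E h mulVf// gt_eqF.
  have a'F chi : F chi -> gabs a' chi <= 1.
    by move=> /Hx0 h; rewrite a'E ler_pdivrMl// mulr1.
  have [theta [th0 th1 Hth]] : exists theta : R, [/\ 0 < theta, theta < 1 &
      forall chi, F chi -> ~ U chi -> gabs a' chi < theta].
    have cK : closed (F `&` ~` U) by apply: closedI => //; exact: open_closedC.
    have [K0|K0] := pselect (F `&` ~` U !=set0); last first.
      exists 2^-1; split; rewrite ?invr_gt0// ?invf_lt1 ?ltr1n//.
      by move=> chi Fchi nU; case: K0; exists chi.
    have [x1 [Fx1 nU1] Hx1] := gabs_max a' cK K0.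
    have lt1 : gabs a' x1 < 1.
      rewrite lt_neqAle a'F// andbT; apply/eqP => h; apply: nU1; apply: FU.
      split => //=; move: h; rewrite a'E => /(congr1 ( *%R m)).
      by rewrite mulVKf ?lt0r_neq0// mulr1.
    have ge0 : 0 <= gabs a' x1 by exact: cabs_ge0.
    exists ((gabs a' x1 + 1) / 2); split; [lra|lra|].
    by move=> chi Fchi nU; have := Hx1 chi (conj Fchi nU); lra.
  pose eta := eps / 2; have eta0 : 0 < eta by rewrite divr_gt0.
  have [k Hk] : exists k, theta ^+ k < eta.
    have := cvg_expr (z := theta); rewrite ger0_norm ?(ltW th0)// => /(_ th1).
    move=> /cvgrPdist_lt/(_ _ eta0)[k _ Hk]; exists k; have := Hk k (leqnn _).
    by rewrite /= sub0r normrN ger0_norm// exprn_ge0// ltW.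
  pose B := 2 * rnorm a'; have B0 : 0 <= B by rewrite mulr_ge0// rnorm_ge0.
  have BX : 0 <= B ^+ k by rewrite exprn_ge0.
  (* On V the factor a'^k is below 1 + eta in modulus, and even below eta outside U. Off V, f is at
     most eta', small enough to absorb the crude bound B^k. *)
  pose V := [set chi | gabs (a' ^+ k) chi < 1 + eta] `&` (U `|` [set chi | gabs a' chi < theta]).
  have oV : open V.
    apply: openI; first exact: gabs_lt_open.
    by apply: openU => //; exact: gabs_lt_open.
  have FV : F `<=` V.
    move=> chi Fchi; split => /=.
      rewrite gabsX (le_lt_trans (y := 1))// ?ltrDl//.
      by rewrite exprn_ile1// ?a'F//; exact: cabs_ge0.
    have [Uchi|nU] := pselect (U chi); first by left.
    by right; exact: Hth.
  pose eta' := eta / (B ^+ k + 1).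
  have Bk : 0 < B ^+ k + 1 by rewrite ltr_wpDl.
  have eta'0 : 0 < eta' by rewrite divr_gt0.
  have eta'B : eta' * (B ^+ k + 1) = eta by rewrite divfK// gt_eqF.
  have eta'1 : eta' <= eta by rewrite ler_pdivrMr// ler_pMr// lerDr.
  have [f [f1 f2 f3]] := F2 _ _ oV FV eta'0.
  have p0 : 0 < 1 + eta by rewrite ltr_wpDl.
  have gE chi : gabs ((1 + eta)^-1%:C%C *: (f * a' ^+ k)) chi =
      (1 + eta)^-1 * (gabs f chi * gabs a' chi ^+ k).
    by rewrite gabsZ cabsR ?gabsM ?gabsX// invr_ge0 ltW.
  have far chi : H chi -> ~ V chi -> gabs f chi * gabs a' chi ^+ k <= eta.
    move=> Hchi nV; have h1 := f3 _ Hchi nV.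
    have h2 : gabs a' chi ^+ k <= B ^+ k.
      by rewrite lerXn2r ?nnegrE//; [exact: cabs_ge0 | exact: gabs_bound].
    have h3 : 0 <= gabs f chi by exact: cabs_ge0.
    have h4 : 0 <= gabs a' chi ^+ k by rewrite exprn_ge0//; exact: cabs_ge0.
    have : gabs f chi * gabs a' chi ^+ k <= eta' * B ^+ k by rewrite ler_pM.
    by rewrite mulrDr mulr1 in eta'B; lra.
  have near chi : H chi -> gabs f chi * gabs a' chi ^+ k <= gabs a' chi ^+ k.
    by move=> Hchi; rewrite ler_piMl ?f1// exprn_ge0//; exact: cabs_ge0.
  exists ((1 + eta)^-1%:C%C *: (f * a' ^+ k)); split.
  + move=> chi Hchi; rewrite gE ler_pdivrMl// mulr1.
    have [[/= Vk _]|nV] := pselect (V chi).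
      by rewrite (le_trans (near _ Hchi))// -gabsX ltW.
    by rewrite (le_trans (far _ Hchi nV))// lerDr.
  + move=> chi [Fchi chim]; rewrite gE a'1// expr1n mulr1 mulrC ler_pdivlMr//.
    have := f2 _ Fchi; have : eps = 2 * eta by rewrite /eta mulrC divfK.
    by move=> ->; nra.
  + move=> chi Hchi nU; rewrite gE ler_pdivrMl//.
    suff : gabs f chi * gabs a' chi ^+ k <= eta.
      by move/le_trans; apply; rewrite (_ : eps = 2 * eta); [nra | rewrite /eta mulrC divfK].
    have [[_ /= [//|Vt]]|nV] := pselect (V chi); last exact: far.
    rewrite (le_trans (near _ Hchi))// (le_trans _ (ltW Hk))//.
    by rewrite lerXn2r ?nnegrE ?(ltW th0) ?(ltW Vt)//; exact: cabs_ge0.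
Qed.

End Faces.

(** * Minimal faces are points *)

Section MinimalFace.
Variables (R : realType) (A : comBanachAlgType R[i]).
Notation Phi := (characters A).
Implicit Types (F H S U : set Phi) (chi psi phi : Phi) (a f : A).

Lemma face_minimal H : closed H -> H !=set0 ->
  exists2 F, face H F & forall F', face H F' -> F' `<=` F -> F `<=` F'.
Proof.
move=> cH H0.
have [D DP totD|C [HC maxC]] := @Zorn_bigcup Phi (fun C => face H (H `\` C)).
  exact: face_chain.
exists (H `\` C) => // F' HF' F'C x [Hx nCx]; apply: contrapT => nF'x.
apply: (maxC (~` F')).
  split; last by move=> /(_ x nF'x).
  by move=> y Cy F'y; have [_] := F'C _ F'y.
rewrite setDE setCK setIidr//; by have [] := HF'.
Qed.

(** Given a second point chi of a minimal face, take b with b(phi) = 0 and b(chi) = 1. Adding a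
    constant T larger than every |b| makes b + T non-vanishing and larger in modulus at chi than at
    phi, so its maximum set is a smaller face. *)
Lemma face_singleton H : closed H -> H !=set0 -> exists phi, face H [set phi].
Proof.
move=> cH H0; have [F HF minF] := face_minimal cH H0.
have [[phi Fphi] _ _ _ _] := HF; exists phi; suff <- : F = [set phi] by [].
apply/seteqP; split; last by move=> _ ->.
move=> chi Fchi /=; apply: contrapT => neq.
have [a Ha] : exists a, gelfand a chi != gelfand a phi.
  apply: contrapT => /forallNP Hn; apply: neq; apply: val_inj; apply/funext => a.
  by apply/eqP; have /negP := Hn a; rewrite negbK.
pose w := gelfand a chi - gelfand a phi.
have w0 : w != 0 by rewrite subr_eq0.
pose b := w^-1 *: (a - (gelfand a phi)%:A).
have hc psi := character_set_val psi.
have bE psi : gelfand b psi = w^-1 * (gelfand a psi - gelfand a phi).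
  by rewrite /gelfand (charZ (hc psi)) (charB (hc psi)) (char_alg (hc psi)).
pose T := 2 * rnorm b + 1; have T0 : 0 < T by rewrite ltr_wpDl// mulr_ge0// rnorm_ge0.
pose d := b + T%:C%C%:A.
have dE psi : gelfand d psi = gelfand b psi + T%:C%C.
  by rewrite /gelfand (charD (hc psi)) (char_alg (hc psi)).
have d0 psi : F psi -> 0 < gabs d psi.
  move=> _; rewrite /gabs dE cabs_gt0; apply/eqP => h.
  have := gabs_bound b psi; rewrite /gabs (_ : gelfand b psi = - T%:C%C).
    rewrite cabsN cabsR; last exact: ltW.
    by apply/negP; rewrite -ltNge /T; lra.
  by apply/eqP; rewrite -addr_eq0 h.
have HG := face_argmax HF d0.
have [_ /(_ _ Fchi)] : [set chi | F chi /\ forall chi', F chi' -> gabs d chi' <= gabs d chi] phi.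
  by apply: (minF _ HG) => // x [].
rewrite /gabs !dE !bE subrr mulr0 add0r mulVf// -[X in X + _](rmorph1 (real_complex R)) -rmorphD/=.
by rewrite !cabsR//; lra.
Qed.

End MinimalFace.

(** * From faces of the hull to the Silov boundary *)

Section SilovPoint.
Variables (R : realType) (A : comBanachAlgType R[i]).
Notation Phi := (characters A).

Definition hull : set Phi := [set phi | forall a, fin_ideal a -> gelfand a phi = 0].

Lemma closed_hull : closed hull.
Proof.
rewrite (_ : hull = \bigcap_(a in @fin_ideal _ A) [set phi | gabs a phi = 0]).
  by apply: closed_bigI => a _; exact: gabs_eq_closed.
apply/seteqP; split => phi Hphi a Ja /=.
  by rewrite /gabs Hphi// cabs0.
by have /eqP := Hphi a Ja; rewrite /= cabs_eq0 => /eqP.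
Qed.

Lemma gelfand_idem (e : A) (chi : Phi) : e * e = e -> gelfand e chi != 0 -> gelfand e chi = 1.
Proof.
move=> ee e0; apply: (mulfI e0); rewrite mulr1.
by rewrite /gelfand -(charM (character_set_val chi)) ee.
Qed.

(** Near each point of K some idempotent of J takes the value 1, and so does every larger one;
    compactness with the filter of large idempotents gives a single e. *)
Lemma fin_idem_separates (K : set Phi) : closed K -> K `&` hull = set0 ->
  exists2 e, @fin_idem _ A e & forall chi, K chi -> gelfand e chi = 1.
Proof.
move=> cK K0.
pose Fil : set_system A := [set Q | exists2 e0, fin_idem e0 &
  forall e, fin_idem e -> e * e0 = e0 -> Q e].
have FilF : Filter Fil.
  split.
  - by exists 0; [exact: fin_idem0 | ].
  - move=> P Q [e he HP] [f hf HQ]; exists (e + f - e * f); first exact: fin_idem_join.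
    move=> d hd dE; split; [apply: HP|apply: HQ] => //.
      by rewrite -{1}(fin_idem_joinl f he) mulrA dE fin_idem_joinl.
    by rewrite -{1}(fin_idem_joinr e hf) mulrA dE fin_idem_joinr.
  - by move=> P Q PQ [e he HP]; exists e => // d hd de; apply: PQ; exact: HP.
have /compact_near_coveringP := @compact_characters R A.
move=> /(_ _ Fil (fun e chi => K chi -> gelfand e chi = 1) FilF)[].
  move=> chi _; have [Kchi|nK] := pselect (K chi); last first.
    exists (~` K, setT) => /=.
      split; first by apply: open_nbhs_nbhs; split => //; exact: closed_openC.
      by exists 0; [exact: fin_idem0|].
    by move=> [x e] [].
  have nH : ~ hull chi by move=> Hchi; have : (K `&` hull) chi by []; rewrite K0.
  move/existsNP: nH => [a] /not_implyP[[e he ea] a0].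
  have e0 : gelfand e chi != 0.
    apply/eqP => e0; apply: a0; rewrite -ea /gelfand (charM (character_set_val chi)).
    by rewrite -/(gelfand e chi) e0 mul0r.
  exists ([set x | gabs (1 - e) x < 1], [set f | fin_idem f /\ f * e = e]) => /=.
    split; last by exists e.
    apply: open_nbhs_nbhs; split; first exact: gabs_lt_open.
    rewrite /= /gabs /gelfand (charB (character_set_val chi)) (char1 (character_set_val chi)).
    by rewrite -/(gelfand e chi) (gelfand_idem _ e0) ?subrr ?cabs0//; case: he.
  move=> [x f] [/= ex [hf fe]] _.
  have ex0 : gelfand e x != 0.
    apply/eqP => e0'; move: ex; rewrite /gabs /gelfand (charB (character_set_val x)).
    rewrite (char1 (character_set_val x)) -/(gelfand e x) e0' subr0 cabs1.
    by rewrite ltxx.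
  apply: gelfand_idem; first by case: hf.
  apply/eqP => fx; move/eqP: ex0; apply.
  by rewrite -fe /gelfand (charM (character_set_val x)) -/(gelfand f x) fx mul0r.
move=> e he He; exists e => // chi; apply: He => //.
by case: he.
Qed.

(** If a closed boundary S avoids phi, take f with |f| >= 3/4 at phi and |f| <= 1/4 on the part of S
    in the hull. With e in J equal to 1 where |f| >= 1/2 on S, the product g = (1 - e)f keeps its
    value at phi and has |g| < 1/2 on S, so the peak set of g misses S. *)
Lemma face_hull_silov (phi : Phi) : face hull [set phi] -> silov A phi.
Proof.
move=> [_ _ HF _ F2] S [cS bS]; apply: contrapT => nS.
have Hphi : hull phi by exact: HF.
have [|||f [f1 f2 f3]] := F2 (~` S) 4^-1 _ _ _.
- exact: closed_openC.
- by move=> _ ->.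
- by rewrite invr_gt0.
pose K := S `&` [set chi | 2^-1 <= gabs f chi].
have cK : closed K.
  apply: closedI => //; rewrite (_ : [set _ | _] = gabs f @^-1` [set y | 2^-1 <= y])//.
  by apply: closed_comp => [chi _|]; [exact: gabs_continuous | exact: closed_ge].
have K0 : K `&` hull = set0.
  apply/seteqP; split => // chi [[Schi /= fchi] Hchi].
  have := f3 _ Hchi; move=> /(_ (fun h => h Schi)); lra.
have [e he He] := fin_idem_separates cK K0.
have hc := @character_set_val R A.
pose g := (1 - e) * f.
have gE chi : gabs g chi = cabs (1 - gelfand e chi) * gabs f chi.
  by rewrite gabsM /gabs /gelfand (charB (hc chi)) (char1 (hc chi)).
have gphi : 3 / 4 <= gabs g phi.
  rewrite gE (Hphi e (fin_idem_in he)) subr0 cabs1 mul1r.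
  have := f2 _ (erefl phi); lra.
have gS chi : S chi -> gabs g chi < 2^-1.
  move=> Schi; have [fl|fl] := leP 2^-1 (gabs f chi).
    by rewrite gE He// subrr cabs0 mul0r invr_gt0.
  rewrite gE; have [e0|e0] := eqVneq (gelfand e chi) 0.
    by rewrite e0 subr0 cabs1 mul1r.
  by rewrite (gelfand_idem _ e0) ?subrr ?cabs0 ?mul0r ?invr_gt0//; case: he.
have [|x1 _ Hx1] := gabs_max g (@closedT Phi); first by exists phi.
pose m := gabs g x1; have m34 : 3 / 4 <= m by rewrite (le_trans gphi)// Hx1.
have m0 : 0 < m by lra.
have [|chi [Schi /= mchi]] := bS [set chi | gabs g chi = m].
  have nE chi : `|gelfand (m^-1%:C%C *: g) chi| = (m^-1 * gabs g chi)%:C%C.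
    by rewrite -cabsE -/(gabs (m^-1%:C%C *: g) chi) gabsZ cabsR// invr_ge0 ltW.
  split; [by exists x1 | exact: gabs_eq_closed |].
  exists (gelfand (m^-1%:C%C *: g)); first by exists (m^-1%:C%C *: g).
  split => chi /= h; rewrite nE.
    by rewrite h mulVf ?gt_eqF.
  rewrite -[1 in ltRHS](rmorph1 (real_complex R)) ltcR ltr_pdivrMl// mulr1.
  rewrite lt_neqAle Hx1// andbT; exact/eqP.
by have := gS _ Schi; rewrite mchi; lra.
Qed.

End SilovPoint.

(** * Contradiction at a point of the Silov boundary *)

Theorem theorem3p3 (R : realType) (A : comBanachAlgType R[i])
    (hA : forall phi : characters A,
      silov A phi -> countably_generated (char_ker phi)) :
  finite_dimensional A.
Proof.
have hnm := @rnorm_banach R A.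
have [/fin_ideal1//|J1] := pselect (@fin_ideal _ A 1).
have hJ := @fin_ideal_ideal _ A.
exfalso.
have [chi hchi Hchi] := ideal_character hnm hJ J1.
have H0 : @hull R A !=set0.
  by exists (SigSub (mem_set hchi : (chi : {ptws A -> R[i]}) \in characters A)) => a /Hchi.
have [phi Hphi] := face_singleton (@closed_hull R A) H0.
have hull_phi : hull phi by have [_ _ h _ _] := Hphi; exact: h.
have hpsi := character_set_val phi.
have [n [g [C [g0 C0 gen]]]] := countably_generated_gens hnm hpsi (hA _ (face_hull_silov Hphi)).
(* J lies in every M^m, because an idempotent e vanishing at phi equals e^m. Stabilisation modulo J
   is therefore genuine stabilisation, and produces an idempotent of J with value 1 at phi. *)
have unstableJ : unstable g (@fin_ideal _ A).
  move=> k Hk.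
  have Jpw m : @fin_ideal _ A `<=` ker_pow g m.
    move=> a [e he ea]; have [ee _] := he.
    have em : ker_pow g m (e ^+ m).
      by apply: (ker_powX hpsi g0 gen); exact: hull_phi (fin_idem_in he).
    have -> : a = e ^+ m * a.
      by elim: m {em} => [|m IH]; rewrite ?expr0 ?mul1r// exprS -mulrA -IH ea.
    exact: ideal_mulr (ker_pow_ideal g m) em.
  have [|e [ee e1 efin]] := ker_pow_idempotent hnm hpsi g0 C0 gen (k := k).
    move=> a /Hk[x Jx ax]; rewrite -(subrK x a); apply: (idealD (ker_pow_ideal g k.+1)) => //.
    exact: Jpw.
  have := hull_phi e (fin_idem_in (conj ee efin)).
  by rewrite /gelfand e1 => /eqP; rewrite oner_eq0.
have [S [SJ Smax [xi Sxi xipsi]]] := character_curve hnm hpsi g0 C0 gen hJ unstableJ.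
pose S' := [set chi : characters A | S (set_val chi)].
have [hxi _] := SJ _ Sxi.
pose xi' : characters A := SigSub (mem_set hxi : (xi : {ptws A -> R[i]}) \in characters A).
have [_ _ _ F1 _] := Hphi.
(* S' satisfies [max_modulus_at] at phi, so the face {phi} contains S'; its element xi' is then phi,
   against the choice of xi. *)
have : [set phi] xi'.
  apply: (F1 phi S') => //.
  - by move=> chi' /SJ[_ h] a /h.
  - move=> a Ha chi' Schi'; apply: (Smax a) => // x Sx.
    have [hx _] := SJ _ Sx.
    exact: (Ha (SigSub (mem_set hx : (x : {ptws A -> R[i]}) \in characters A)) Sx).
by move=> E; apply: xipsi; rewrite -[RHS]/(set_val phi) -E.
Qed.
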